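(* Let $\{x^k\},\{\lambda^k\},\{w^k\},\{\rho_k\}$ be sequences generated by the augmented Lagrangian method (described in the context). Assume that (i) $F$ is bounded and pseudomonotone, (ii) the mappings $G:X\times X\to Y$ and $D_yG:X\times X\to L(X,Y)$ are completely continuous, and (iii) $x^{k+1}\in C$ and $\varepsilon^{k+1}-\mathcal{L}_{\rho_k}(x^{k+1},w^k)\in\mathcal{N}_C(x^{k+1})$ for all $k$, where $\{\varepsilon^k\}\subseteq X^*$ satisfies $\varepsilon^k\to0$. Let $I\subseteq\mathbb{N}$ be an infinite subset such that $\{x^k\}_{k\in I}$ converges weakly to $\bar{x}$, and assume that $\bar{x}$ satisfies the extended Robinson constraint qualification (ERCQ). Then $\bar{x}$ is feasible (i.e. $\bar{x}\in C$ and $G(\bar{x},\bar{x})\in K$), the sequence $\{\lambda^k\}_{k\in I}$ is bounded in $Y^*$, and each of its weak-$^*$ accumulation points is a Lagrange multiplier corresponding to $\bar{x}$, i.e. an element $\bar{\lambda}\in Y^*$ with $$-\bigl(F(\bar{x})+D_yG(\bar{x},\bar{x})^*\bar{\lambda}\bigr)\in\mathcal{N}_C(\bar{x})\quad\text{and}\quad\bar{\lambda}\in\mathcal{N}_K(G(\bar{x},\bar{x})).$$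
   Context: Setting. $X,Y$ are real Banach spaces; $C\subseteq X$, $K\subseteq Y$ are nonempty closed convex sets; $F:X\to X^*$; $G:X\times X\to Y$ is Fréchet differentiable with respect to its second argument $y$, with derivative $D_yG(x,y)\in L(X,Y)$. $H$ is a real Hilbert space, $i:Y\hookrightarrow H$ is a continuous linear injection with dense range, and $\mathcal{K}\subseteq H$ is a closed convex set with $i^{-1}(\mathcal{K})=K$. Elements of $Y$ are identified with their images in $H$, and $\lambda\in H$ is identified with the element $y\mapsto(\lambda,i(y))_H$ of $Y^*$. $P_{\mathcal{K}}$ is the projection onto $\mathcal{K}$ in $H$. For a convex subset $S$ of a Banach space $Z$ and $z\in S$, $\mathcal{N}_S(z)=\{\psi\in Z^*:\langle\psi,s-z\rangle\le0\ \forall s\in S\}$. Augmented Lagrangian: for $x\in X$, $\lambda\in H$, $\rho>0$, $\mathcal{L}_\rho(x,\lambda):=F(x)+\rho D_yG(x,x)^*[G(x,x)+\lambda/\rho-P_{\mathcal{K}}(G(x,x)+\lambda/\rho)]\in X^*$. Also $V(x,\lambda,\rho):=\|G(x,x)-P_{\mathcal{K}}(G(x,x)+\lambda/\rho)\|_H$. Augmented Lagrangian method. Given $(x^0,\lambda^0)\in X\times H$, $\rho_0>0$, $\gamma>1$, $\tau\in(0,1)$ and a bounded set $B\subseteq H$, for $k=0,1,2,\dots$: choose $w^k\in B$; compute $x^{k+1}$ as an inexact solution of the variational inequality $x\in C$, $\langle\mathcal{L}_{\rho_k}(x,w^k),y-x\rangle\ge0$ for all $y\in C$ (the inexactness is that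 of hypothesis (iii)); set $\lambda^{k+1}:=\rho_k[G(x^{k+1},x^{k+1})+w^k/\rho_k-P_{\mathcal{K}}(G(x^{k+1},x^{k+1})+w^k/\rho_k)]$; if $k=0$ or $V(x^{k+1},w^k,\rho_k)\le\tau V(x^k,w^{k-1},\rho_{k-1})$, set $\rho_{k+1}:=\rho_k$, otherwise $\rho_{k+1}:=\gamma\rho_k$. The method is assumed not to terminate, so infinite sequences are generated. Bounded operator: maps bounded sets to bounded sets. Pseudomonotone (Brezis): $T:X\to X^*$ such that, whenever $x^k\rightharpoonup x$ and $\limsup_k\langle T(x^k),x^k-x\rangle\le0$, then $\langle T(x),x-y\rangle\le\liminf_k\langle T(x^k),x^k-y\rangle$ for all $y\in X$. Completely continuous: $z^k\rightharpoonup z$ implies $T(z^k)\to T(z)$ in norm. ERCQ holds in $x\in X$ (not necessarily feasible) if $0\in\operatorname{int}[G(x,x)+D_yG(x,x)(C-x)-K]$ (interior in $Y$). *)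

(* Defs.v *)
From HB Require Import structures.
From mathcomp Require Import all_boot all_order all_algebra.
From mathcomp Require Import ring lra.
From mathcomp Require Import all_classical all_reals all_analysis.
Import numFieldNormedType.Exports.
Import Order.TTheory GRing.Theory Num.Theory.

Set Implicit Arguments.
Unset Strict Implicit.
Unset Printing Implicit Defensive.

Local Open Scope classical_set_scope.
Local Open Scope ring_scope.

Section ContinuousLinear.
Context {R : realType}.
Variables X Y : normedModType R.

Definition continuous_linear_pred : {pred X -> Y} :=
  fun f => `[< linear f /\ continuous f >].

(* The space L(X, Y). *)
Record continuous_linear := ContinuousLinear {
  continuous_linear_fun :> X -> Y;
  continuous_linear_subproof : continuous_linear_fun \in continuous_linear_pred }.

HB.instance Definition _ := [isSub for continuous_linear_fun].
HB.instance Definition _ := [Choice of continuous_linear by <:].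

Fact continuous_linear_submod_closed : submod_closed continuous_linear_pred.
Proof.
split.
  apply/asboolP; split=> [a u v|x]; last exact: cvg_cst.
  by change (0 = a *: (0 : Y) + 0); rewrite scaler0 addr0.
move=> a f g /asboolP[lf cf] /asboolP[lg cg]; apply/asboolP; split=> [b u v|x].
  change (a *: f (b *: u + v) + g (b *: u + v) =
          b *: (a *: f u + g u) + (a *: f v + g v)).
  by rewrite lf lg !scalerDr !scalerA (mulrC a b) addrACA.
by apply: cvgD; [apply: cvgZr; exact: cf|exact: cg].
Qed.

HB.instance Definition _ := GRing.isSubmodClosed.Build R (X -> Y)
  continuous_linear_pred continuous_linear_submod_closed.
HB.instance Definition _ := [SubChoice_isSubLmodule of continuous_linear by <:].

Fact continuous_linear_isLinear (f : continuous_linear) : linear f.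
Proof. by have /asboolP[] := continuous_linear_subproof f. Qed.

HB.instance Definition _ (f : continuous_linear) :=
  GRing.isLinear.Build R X Y _ f (continuous_linear_isLinear f).

Fact continuous_linear_continuous (f : continuous_linear) : continuous f.
Proof. by have /asboolP[] := continuous_linear_subproof f. Qed.

Definition opnorm (f : continuous_linear) : R :=
  sup [set `|f x| | x in [set x : X | `|x| <= 1]].

Fact opnorm_has_sup (f : continuous_linear) :
  has_sup [set `|f x| | x in [set x : X | `|x| <= 1]].
Proof.
split; first by exists `|f 0|, 0 => //=; rewrite normr0.
have /linear_boundedP := @continuous_linear_bounded _ _ _ 0 f (@continuous_linear_continuous f 0).
move=> [M [Mr /(_ (M + 1))]]; rewrite ltrDl ltr01 => /(_ isT) fM.
exists `|M + 1| => _ [x /= x1 <-]; apply: (le_trans (fM x)).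
apply: (@le_trans _ _ (`|M + 1| * `|x|)); first by rewrite ler_wpM2r// ler_norm.
by rewrite ler_piMr.
Qed.

Fact opnorm_ub (f : continuous_linear) (x : X) : `|x| <= 1 -> `|f x| <= opnorm f.
Proof.
by move=> x1; apply: sup_ubound; [case: (opnorm_has_sup f)|exists x].
Qed.

Fact opnorm_le (f : continuous_linear) (M : R) :
  (forall x, `|x| <= 1 -> `|f x| <= M) -> opnorm f <= M.
Proof.
move=> fM; apply: ge_sup; first by case: (opnorm_has_sup f).
by move=> _ [x /= x1 <-]; exact: fM.
Qed.

Fact opnorm_ge0 (f : continuous_linear) : 0 <= opnorm f.
Proof. by apply: (le_trans _ (@opnorm_ub f 0 _)); rewrite ?normr0. Qed.

Fact opnormD (f g : continuous_linear) : opnorm (f + g) <= opnorm f + opnorm g.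
Proof.
apply: opnorm_le => x x1.
by apply: (le_trans (ler_normD _ _)); apply: lerD; exact: opnorm_ub.
Qed.

Fact opnormZ (a : R) (f : continuous_linear) : opnorm (a *: f) = `|a| * opnorm f.
Proof.
have leZ b g : opnorm (b *: g) <= `|b| * opnorm g.
  by apply: opnorm_le => x x1; rewrite normrZ ler_wpM2l// opnorm_ub.
apply/eqP; rewrite eq_le leZ /=.
have [->|a0] := eqVneq a 0; first by rewrite normr0 mul0r opnorm_ge0.
rewrite -ler_pdivlMl ?normr_gt0// -normfV.
by apply: le_trans (leZ _ _); rewrite scalerA mulVf// scale1r.
Qed.

Fact opnorm_eq0 (f : continuous_linear) : opnorm f = 0 -> f = 0.
Proof.
move=> f0; apply: val_inj; apply/funext => x /=.
have [->|x0] := eqVneq x 0; first by rewrite linear0.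
have : `|f (`|x|^-1 *: x)| <= 0.
  by rewrite -f0; apply: opnorm_ub; rewrite normrZ normfV normr_id mulVf// normr_eq0.
rewrite normr_le0 linearZ/= scaler_eq0 invr_eq0 normr_eq0 (negPf x0)/=.
by move=> /eqP.
Qed.

HB.instance Definition _ :=
  Lmodule_isNormed.Build R continuous_linear opnormD opnormZ opnorm_eq0.

End ContinuousLinear.

Arguments continuous_linear_pred {R X Y}.

Definition dual {R : realType} (X : normedModType R) :=
  continuous_linear X R^o.
HB.instance Definition _ (R : realType) (X : normedModType R) :=
  NormedModule.on (dual X).

Section Adjoint.
Context {R : realType} {X Y : normedModType R}.

Fact adjoint_subproof (T : continuous_linear X Y) (psi : dual Y) :
  (fun x => psi (T x) : R^o) \in continuous_linear_pred.
Proof.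
apply/asboolP; split=> [a u v|x]; first by rewrite !linearP.
by apply: continuous_comp; exact: continuous_linear_continuous.
Qed.

Definition adjoint (T : continuous_linear X Y) (psi : dual Y) : dual X :=
  ContinuousLinear (adjoint_subproof T psi).

End Adjoint.

(* With `H : completeNormedModType R`, this makes H a real Hilbert space. *)
Record inner_product {R : realType} (H : normedModType R) := InnerProduct {
  inner_product_form :> {dot H for idfun};
  inner_product_norm : forall u, inner_product_form u u = `|u| ^+ 2 }.

Section Riesz.
Context {R : realType} {H : normedModType R} (ip : inner_product H).

Fact inner_productC (u v : H) : ip u v = ip v u.
Proof. by rewrite (hermitian_subproof u v) expr0 mul1r. Qed.

Fact inner_product_le (u v : H) : ip u v <= `|u| * `|v|.
Proof.
have : ip (u + v) (u + v) <= (`|u| + `|v|) ^+ 2.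
  by rewrite inner_product_norm lerXn2r ?nnegrE ?addr_ge0 ?ler_normD.
rewrite linearDl/= !linearD/= !inner_product_norm (inner_productC v u).
by rewrite sqrrD; lra.
Qed.

Fact ler_norm_inner_product (u v : H) : `|ip u v| <= `|u| * `|v|.
Proof.
rewrite ler_norml inner_product_le andbT lerNl -(linearN (ip u)).
by rewrite -(normrN v) inner_product_le.
Qed.

Fact riesz_subproof (u : H) : (ip u : H -> R^o) \in continuous_linear_pred.
Proof.
apply/asboolP; split=> [a v w|]; first exact: linearP.
have lu : linear (ip u : H -> R^o) by move=> a v w; exact: linearP.
pose l : {linear H -> R^o} :=
  HB.pack (ip u : H -> R^o) (GRing.isLinear.Build _ _ _ _ _ lu).
apply: (@bounded_linear_continuous _ _ _ l); apply/linear_boundedP.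
exists `|u|; split=> [|r /ltW ur x]; first exact: num_real.
by rewrite (le_trans (ler_norm_inner_product u x))// ler_wpM2r.
Qed.

(* The functional $(u, \cdot)_H$ on H. *)
Definition riesz (u : H) : dual H := ContinuousLinear (riesz_subproof u).

End Riesz.

(* An element $\lambda$ of H as the functional $y \mapsto (\lambda, i(y))_H$. *)
Definition pivot {R : realType} {Y H : normedModType R} (ip : inner_product H)
  (i : continuous_linear Y H) (lam : H) : dual Y := adjoint i (riesz ip lam).

(* Unique minimiser when [S] is nonempty, closed and convex in a Hilbert space;
   [get] is arbitrary otherwise. *)
Definition metric_projection {R : realType} {H : normedModType R} (S : set H)
    (z : H) : H :=
  get [set p | S p /\ forall q, S q -> `|z - p| <= `|z - q|].

(* Meaningful only for $z \in S$. *)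
Definition normal_cone {R : realType} {Z : normedModType R} (S : set Z)
    (z : Z) : set (dual Z) :=
  [set psi | forall s, S s -> psi (s - z) <= 0].

Definition weakly_cvg {R : realType} {X : normedModType R} (F : set_system X)
    (x : X) : Prop :=
  forall psi : dual X, psi z @[z --> F] --> psi x.

Definition weak_star_topology {R : realType} (Y : normedModType R) : Type :=
  initial_topology (fun psi : dual Y => (psi : {ptws Y -> R^o})).
HB.instance Definition _ (R : realType) (Y : normedModType R) :=
  Topological.on (weak_star_topology Y).

Definition weak_star_accumulation_points {R : realType} {Y : normedModType R}
    (F : set_system (dual Y)) : set (dual Y) :=
  @cluster (weak_star_topology Y) F.

Definition bounded_operator {R : realType} {X Z : normedModType R}
    (T : X -> Z) : Prop :=
  forall A : set X, bounded_set A -> bounded_set (T @` A).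

Definition pseudomonotone {R : realType} {X : normedModType R}
    (T : X -> dual X) : Prop :=
  forall (x : nat -> X) (x0 : X), weakly_cvg (x @ \oo) x0 ->
    (limn_esup (fun k => (T (x k) (x k - x0))%:E) <= 0)%E ->
    forall y, ((T x0 (x0 - y))%:E <= limn_einf (fun k => (T (x k) (x k - y))%:E))%E.

Definition completely_continuous {R : realType} {Z W : normedModType R}
    (T : Z -> W) : Prop :=
  forall (z : nat -> Z) (z0 : Z), weakly_cvg (z @ \oo) z0 ->
    T (z k) @[k --> \oo] --> T z0.

Section QuasiVariationalInequality.
Context {R : realType} {X Y : normedModType R}.
Variables (C : set X) (K : set Y).
Variables (F : X -> dual X) (G : X -> X -> Y).
Variable DG : X -> X -> continuous_linear X Y.

Definition ERCQ (x : X) : Prop :=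
  interior [set G x x + DG x x (c - x) - k | c in C & k in K] 0.

Definition Lagrange_multiplier (x : X) (lam : dual Y) : Prop :=
  normal_cone C x (- (F x + adjoint (DG x x) lam)) /\
  normal_cone K (G x x) lam.

End QuasiVariationalInequality.

Section AugmentedLagrangianMethod.
Context {R : realType} {X Y H : normedModType R}.
Variables (ip : inner_product H) (i : continuous_linear Y H) (calK : set H).
Variables (F : X -> dual X) (G : X -> X -> Y).
Variable DG : X -> X -> continuous_linear X Y.

Definition shifted_constraint (x : X) (lam : H) (rho : R) : H :=
  i (G x x) + rho^-1 *: lam.

Definition augmented_Lagrangian (rho : R) (x : X) (lam : H) : dual X :=
  let z := shifted_constraint x lam rho in
  F x + rho *: adjoint (DG x x) (pivot ip i (z - metric_projection calK z)).

Definition infeasibility (x : X) (lam : H) (rho : R) : R :=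
  `|i (G x x) - metric_projection calK (shifted_constraint x lam rho)|.

(* The inexact solution of the subproblems is a separate assumption on [x].
   In the penalty update, [k == 0] shields the junk values at [k.-1]. *)
Record ALM_sequences (gamma tau : R) (B : set H)
    (x : nat -> X) (lam w : nat -> H) (rho : nat -> R) : Prop := {
  ALM_rho0 : 0 < rho 0%N;
  ALM_gamma : 1 < gamma;
  ALM_tau : 0 < tau < 1;
  ALM_bounded : bounded_set B;
  ALM_safeguard : forall k, B (w k);
  ALM_multiplier : forall k, let z := shifted_constraint (x k.+1) (w k) (rho k) in
    lam k.+1 = rho k *: (z - metric_projection calK z);
  ALM_penalty : forall k, rho k.+1 =
    if (k == 0%N) || (infeasibility (x k.+1) (w k) (rho k) <=
                    tau * infeasibility (x k) (w k.-1) (rho k.-1))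
    then rho k else gamma * rho k }.

End AugmentedLagrangianMethod.

(* Main.v *)
Require Import Defs.
From HB Require Import structures.
From mathcomp Require Import all_boot all_order all_algebra.
From mathcomp Require Import ring lra.
From mathcomp Require Import all_classical all_reals all_analysis.
Import numFieldNormedType.Exports.
Import Order.TTheory GRing.Theory Num.Theory.

Set Implicit Arguments.
Unset Strict Implicit.
Unset Printing Implicit Defensive.

Local Open Scope classical_set_scope.
Local Open Scope ring_scope.

(** Write $g_k = G(x^k,x^k)$, $D_k = D_yG(x^k,x^k)$, let $p_k$ be the projection
onto $\mathcal K$ of $g_k + w^{k-1}/\rho_{k-1}$ and $v_k = \|g_k - p_k\|_H$.
Everything follows from two inequalities that hold at each iterate.

- [stationarity_inequality]: for $c \in C$,
  $\langle \varepsilon^k - F(x^k), c - x^k\rangle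
   \le \langle \lambda^k, D_k(c - x^k)\rangle$.  The left-hand side is bounded
  along $I$, because weakly convergent sequences are bounded and $F$ is a bounded
  operator.
- [multiplier_inequality]: for $s \in \mathcal K$,
  $(\lambda^k, s - g_k)_H \le \|w^{k-1}\| v_k$.  The residual of a projection
  makes an obtuse angle with every $s - p_k$, and
  $\lambda^k = \rho_{k-1}(g_k - p_k) + w^{k-1}$.

Passing to the limit.  Complete continuity turns the weak convergence of $x^k$ into
norm convergence of $g_k$ and $D_k$; as the derivative of a completely continuous
map is completely continuous ([completely_continuous_derivative]), also
$D_k(y - x^k) \to D_yG(\bar x,\bar x)(y - \bar x)$ in norm.

Feasibility.  Either the penalty test succeeds from some index on, and then
$v_k \to 0$ geometrically, or $\rho_k \to \infty$ ([penalty_dichotomy]).  In the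
second case the first inequality, divided by $\rho_{k-1}$, says in the limit that
the residual $d = G(\bar x,\bar x) - P_{\mathcal K}(G(\bar x,\bar x))$ satisfies
$(d, D_yG(\bar x,\bar x)(c - \bar x)) \ge 0$ on $C$; pairing $d$ with a
representation of $0$ provided by ERCQ gives $\|d\|^2 \le 0$.  In both cases
$v_k \to 0$ along $I$.

Boundedness ([multipliers_bounded]).  By ERCQ a small multiple of any $y \in Y$ is
$G(\bar x,\bar x) + D_yG(\bar x,\bar x)(c - \bar x) - \kappa$, and the two
inequalities give
$\langle\lambda^k, y\rangle \ge -m_y(1 + \delta_k\|\lambda^k\|)$
with $\delta_k \to 0$ independent of $y$.  The functionals
$\lambda^k/(1 + \delta_k\|\lambda^k\|)$ are thus pointwise bounded, hence bounded in
norm by Banach-Steinhaus, and $\delta_k \to 0$ lets one absorb the denominator.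
The constants $m_y$, which involve the points $c$ and $\kappa$ that represent $y$, may
depend on $y$ in any way.

Accumulation points.  A weak-* accumulation point need not be the limit of a
subsequence.  Each of the two normal cone conditions, however, tests
$\bar\lambda$ at one vector at a time, and for a fixed vector $d$ there is a
subsequence along which $\langle\lambda^k, d\rangle \to \langle\bar\lambda, d\rangle$.
Pseudomonotonicity is applied along such a subsequence.

Behind these steps are a Hahn-Banach theorem, which gives $\bar x \in C$ through the weak
closedness of closed convex sets; the completeness of dual spaces, so that
Banach-Steinhaus bounds weakly convergent sequences; and the projection onto a closed
convex subset of a Hilbert space. *)

(** * Hahn-Banach theorem for sublinear functionals *)

Section HahnBanach.
Context {R : realType} {V : lmodType R}.
Implicit Types (q : V -> R) (A : set V).

Definition sublinear q :=
  (forall u v, q (u + v) <= q u + q v) /\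
  (forall (t : R) v, 0 <= t -> q (t *: v) = t * q v).

Lemma convex_set_conv A (t : R) u v : convex_set A -> 0 <= t -> t <= 1 ->
  A u -> A v -> A (t *: u + (1 - t) *: v).
Proof.
move=> cA t0 t1 Au Av.
by have := cA u v (Itv01 t0 t1); rewrite !inE => /(_ Au Av).
Qed.

Lemma convex_set_cone A (t s : R) u v : convex_set A -> 0 <= t -> 0 <= s ->
  A u -> A v -> exists2 w, A w & t *: u + s *: v = (t + s) *: w.
Proof.
move=> cA t0 s0 Au Av; have [ts0|ts0] := eqVneq (t + s) 0.
  have [-> ->] : t = 0 /\ s = 0 by split; lra.
  by exists u => //; rewrite addr0 !scale0r addr0.
have tsp : 0 < t + s by rewrite lt0r ts0 addr_ge0.
exists ((t / (t + s)) *: u + (1 - t / (t + s)) *: v).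
  apply: convex_set_conv => //; first by rewrite divr_ge0// ltW.
  by rewrite ler_pdivrMr// mul1r lerDl.
rewrite scalerDr !scalerA; congr (_ *: _ + _ *: _); first by field.
by field.
Qed.

(** For convex [A] and [q >= d] on [A], the largest sublinear functional below [q] whose
value at each [- a], [a \in A], is at most [- d].  With [A] a singleton this is the step
that makes a minimal sublinear functional odd; with a general [A] it forces the lower
bound [d] on [A]. *)
Definition tilted q A (d : R) (v : V) : R :=
  inf [set q (v + t *: a) - t * d | t in [set t | 0 <= t] & a in A].

Section Tilted.
Variables (q : V -> R) (A : set V) (d : R).
Hypotheses (q_sub : sublinear q) (A0 : A !=set0) (cA : convex_set A).
Hypothesis q_ge : forall a, A a -> d <= q a.

Let qD u v : q (u + v) <= q u + q v. Proof. exact: q_sub.1. Qed.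
Let qZ (t : R) v : 0 <= t -> q (t *: v) = t * q v. Proof. exact: q_sub.2. Qed.

Let q0 : q 0 = 0. Proof. by rewrite -(scale0r 0) qZ// mul0r. Qed.

(* Subadditivity at $v = (v + ta) - ta$ keeps the infimum finite because $q \ge d$ on A. *)
Let tilted_lb v (t : R) a : 0 <= t -> A a -> - q (- v) <= q (v + t *: a) - t * d.
Proof.
move=> t0 Aa; have := qD (v + t *: a) (- v).
rewrite addrAC subrr add0r qZ// => h.
have : t * d <= t * q a by rewrite ler_wpM2l// q_ge.
by lra.
Qed.

Let tilted_has_inf v :
  has_inf [set q (v + t *: a) - t * d | t in [set t | 0 <= t] & a in A].
Proof.
split; first by have [a Aa] := A0; exists (q (v + 0 *: a) - 0 * d), 0 => //=; exists a.
by exists (- q (- v)) => _ [t /= t0 [a Aa <-]]; exact: tilted_lb.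
Qed.

Let tilted_le v (t : R) a : 0 <= t -> A a -> tilted q A d v <= q (v + t *: a) - t * d.
Proof.
move=> t0 Aa; apply: ge_inf; first by case: (tilted_has_inf v).
by exists t => //; exists a.
Qed.

Let le_tilted v (m : R) : (forall (t : R) a, 0 <= t -> A a -> m <= q (v + t *: a) - t * d) ->
  m <= tilted q A d v.
Proof.
move=> h; apply: lb_le_inf; first by case: (tilted_has_inf v).
by move=> _ [t /= t0 [a Aa <-]]; exact: h.
Qed.

Lemma tilted_le_id v : tilted q A d v <= q v.
Proof.
have [a Aa] := A0; have := @tilted_le v 0 a (lexx _) Aa.
by rewrite scale0r addr0 mul0r subr0.
Qed.

Lemma tilted_oppr a : A a -> tilted q A d (- a) <= - d.
Proof.
move=> Aa; have := @tilted_le (- a) 1 a ler01 Aa.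
by rewrite scale1r addNr q0 mul1r sub0r.
Qed.

Lemma tilted_sublinear : sublinear (tilted q A d).
Proof.
have tZ (t : R) v : 0 < t -> t * tilted q A d v <= tilted q A d (t *: v).
  move=> t0; apply: le_tilted => s a s0 Aa.
  have := @tilted_le v (s / t) a (divr_ge0 s0 (ltW t0)) Aa.
  rewrite -(ler_pM2l t0) => /le_trans; apply.
  have st : t * (s / t) = s by rewrite mulrC divfK ?gt_eqF.
  by rewrite mulrBr -(qZ _ (ltW t0)) scalerDr scalerA [t * (_ * d)]mulrA st.
split=> [u v|t v].
  rewrite -lerBlDr; apply: le_tilted => t a t0 Aa.
  rewrite lerBlDr -lerBlDl; apply: le_tilted => s b s0 Ab.
  rewrite lerBlDl.
  have [c Ac abc] := convex_set_cone cA t0 s0 Aa Ab.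
  apply: le_trans (tilted_le _ (addr_ge0 t0 s0) Ac) _.
  rewrite -abc addrACA; have := qD (u + t *: a) (v + s *: b); lra.
rewrite le_eqVlt => /orP[/eqP<-|t0].
  rewrite mul0r scale0r; apply/le_anti.
  rewrite (le_trans (tilted_le_id 0)) ?q0//=; apply: le_tilted => r a r0 Aa.
  by apply: le_trans (tilted_lb 0 r0 Aa); rewrite oppr0 q0 oppr0.
apply/le_anti/andP; split; last exact: tZ.
have := tZ t^-1 (t *: v); rewrite invr_gt0 scalerA mulVf ?gt_eqF// scale1r.
by move=> /(_ t0); rewrite ler_pdivrMl.
Qed.

End Tilted.

(** Tilting a minimal [q] at [[set v]] with [d = q v] cannot change it, so
$q(-v) \le -q(v)$: a minimal sublinear functional is odd, and subadditivity together
with oddness is additivity. *)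
Lemma minimal_sublinear_linear q : sublinear q ->
  (forall p, sublinear p -> (forall v, p v <= q v) -> p = q) ->
  linear (q : V -> R^o).
Proof.
move=> q_sub q_min; have [qD qZ] := q_sub.
have qN v : q (- v) = - q v.
  have sub1 : convex_set [set v].
    move=> a b l; rewrite !inE => -> ->.
    by rewrite /= convmm.
  have hge a : [set v] a -> q v <= q a by move=> ->.
  have nonempty : [set v] !=set0 by exists v.
  have := tilted_oppr q_sub nonempty hge (erefl : [set v] v).
  rewrite (q_min _ (tilted_sublinear q_sub nonempty sub1 hge) (tilted_le_id q_sub nonempty hge)).
  move=> h; apply/le_anti; rewrite h /=.
  have := qD v (- v); rewrite subrr -(scale0r 0) qZ// mul0r; lra.
have qZ' t v : q (t *: v) = t * q v.
  have [t0|t0] := leP 0 t; first exact: qZ.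
  by apply: oppr_inj; rewrite -qN -scaleNr qZ ?mulNr// oppr_ge0 ltW.
move=> t u v; change (q (t *: u + v) = t * q u + q v).
rewrite -qZ'; apply/le_anti; rewrite qD /=.
have := qD (- (t *: u)) (- v); rewrite -opprD !qN; lra.
Qed.

Lemma sublinear0 q : sublinear q -> q 0 = 0.
Proof. by move=> [_ qZ]; rewrite -(scale0r 0) qZ// mul0r. Qed.

Lemma sublinear_ge q v : sublinear q -> - q (- v) <= q v.
Proof.
move=> q_sub; have := q_sub.1 v (- v).
rewrite subrr sublinear0//; lra.
Qed.

(** For the infimum to be subadditive, two members of the family must have a common lower
bound in it; in a chain the smaller of the two serves. *)
Lemma chain_inf_sublinear (P : set (V -> R)) q : P !=set0 -> sublinear q ->
  (forall p, P p -> sublinear p /\ forall v, p v <= q v) ->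
  (forall p p', P p -> P p' -> (forall v, p v <= p' v) \/ (forall v, p' v <= p v)) ->
  sublinear (fun v => inf [set p v | p in P]) /\
  forall p v, P p -> inf [set p v | p in P] <= p v.
Proof.
move=> [p0 Pp0] q_sub Psub Ptot.
have Phi v : has_inf [set p v | p in P].
  split; first by exists (p0 v), p0.
  exists (- q (- v)) => _ [p Pp <-]; have [p_sub pq] := Psub _ Pp.
  by apply: le_trans (sublinear_ge v p_sub); rewrite lerN2 pq.
have inf_le p v : P p -> inf [set p v | p in P] <= p v.
  by move=> Pp; apply: ge_inf; [case: (Phi v)|exists p].
have inf_ge v (m : R) : (forall p, P p -> m <= p v) -> m <= inf [set p v | p in P].
  move=> h; apply: lb_le_inf; first by case: (Phi v).
  by move=> _ [p Pp <-]; exact: h.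
split=> //; split=> [u v|t v].
  rewrite -lerBlDr; apply: (inf_ge _ _) => p Pp.
  rewrite lerBlDr -lerBlDl; apply: (inf_ge _ _) => p' Pp'.
  rewrite lerBlDl; have [pp'|p'p] := Ptot _ _ Pp Pp'.
    apply: le_trans (inf_le _ _ Pp) _; apply: le_trans ((Psub _ Pp).1.1 _ _) _.
    by rewrite lerD2l.
  apply: le_trans (inf_le _ _ Pp') _; apply: le_trans ((Psub _ Pp').1.1 _ _) _.
  by rewrite lerD2r.
rewrite le_eqVlt => /orP[/eqP<-|t0].
  rewrite scale0r mul0r; apply/le_anti.
  have p00 p : P p -> p 0 = 0 by move=> /Psub[/sublinear0].
  rewrite -{1}(p00 _ Pp0) inf_le//=; apply: (inf_ge _ _) => p Pp.
  by rewrite p00.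
apply/le_anti/andP; split.
  rewrite -ler_pdivrMl//; apply: (inf_ge _ _) => p Pp.
  by rewrite ler_pdivrMl// -((Psub _ Pp).1.2 _ _ (ltW t0)) inf_le.
apply: (inf_ge _ _) => p Pp; rewrite ((Psub _ Pp).1.2 _ _ (ltW t0)) ler_pM2l//.
exact: inf_le.
Qed.

Lemma linear_below_sublinear q : sublinear q ->
  exists f : V -> R, linear (f : V -> R^o) /\ forall v, f v <= q v.
Proof.
move=> q_sub.
pose T := {p : V -> R | sublinear p /\ forall v, p v <= q v}.
pose below (p p' : T) := `[< forall v, sval p' v <= sval p v >].
have [||||p p_min] := @Zorn T below.
- by move=> p; apply/asboolP.
- move=> p p' p'' /asboolP pp' /asboolP p'p''; apply/asboolP => v.
  exact: le_trans (pp' v).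
- move=> [p Hp] [p' Hp'] /asboolP/= pp' /asboolP/= p'p; apply: eq_exist.
  by apply/funext => v; apply/le_anti; rewrite pp' p'p.
- move=> A Atot; have [[p Ap]|A0] := pselect (A !=set0); last first.
    exists (exist _ q (conj q_sub (fun v => lexx _))) => p Ap.
    by exfalso; apply: A0; exists p.
  have [||||inf_sub inf_le] := @chain_inf_sublinear [set sval p | p in A] q.
  + by exists (sval p), p.
  + by [].
  + by move=> _ [p' _ <-]; exact: svalP p'.
  + move=> _ _ [r Ar <-] [s As <-].
    by have [/asboolP|/asboolP] := Atot _ _ Ar As; [right|left].
  set m : V -> R := fun _ => _ in inf_sub.
  have mq v : m v <= q v.
    apply: le_trans (inf_le (sval p) v _) _; first by exists p.
    by case: (svalP p).
  exists (exist _ m (conj inf_sub mq)) => s As; apply/asboolP => v /=.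
  by apply: inf_le; exists s.
have [p_sub pq] := svalP p.
exists (sval p); split=> //; apply: minimal_sublinear_linear => // p' p'_sub p'p.
have p'q v : p' v <= q v by exact: le_trans (pq v).
by rewrite -(p_min (exist _ p' (conj p'_sub p'q)))//; apply/asboolP.
Qed.

(** A linear functional below [tilted q A d] is automatically at least [d] on [A],
because $f(-a) \le -d$. *)
Theorem hahn_banach_sandwich q A (d : R) : sublinear q -> A !=set0 ->
  convex_set A -> (forall a, A a -> d <= q a) ->
  exists f : V -> R, [/\ linear (f : V -> R^o), forall v, f v <= q v
    & forall a, A a -> d <= f a].
Proof.
move=> q_sub A0 cA q_ge.
have [f [lf fq]] := linear_below_sublinear (tilted_sublinear q_sub A0 cA q_ge).
exists f; split=> // [v|a Aa].
  exact: le_trans (tilted_le_id q_sub A0 q_ge v).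
have fN : f (- a) = - f a.
  have := lf (-1) a 0; rewrite scaleN1r !addr0.
  have := lf 1 0 0; rewrite !scale1r !addr0 => f0 ->.
  have -> : f 0 = 0 by have : f 0 = f 0 + f 0 := f0; lra.
  by rewrite addr0 scaleN1r.
have := le_trans (fq _) (tilted_oppr q_sub A0 q_ge Aa).
by rewrite fN lerN2.
Qed.

End HahnBanach.

(** * Separation in normed spaces *)

Section ContinuousLinear.
Context {R : realType} {X Y : normedModType R}.
Implicit Types f : continuous_linear X Y.

Lemma ler_opnorm f x : `|f x| <= `|f| * `|x|.
Proof.
have [->|x0] := eqVneq x 0; first by rewrite linear0 !normr0 mulr0.
have xp : 0 < `|x| by rewrite normr_gt0.
have := @opnorm_ub _ _ _ f (`|x|^-1 *: x).
rewrite normrZ normfV normr_id mulVf ?gt_eqF// => /(_ (lexx _)).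
by rewrite linearZ/= normrZ normfV normr_id ler_pdivrMl// mulrC.
Qed.

Lemma opnorm_le_bound f M : 0 <= M -> (forall x, `|f x| <= M * `|x|) -> `|f| <= M.
Proof.
move=> M0 fM; apply: opnorm_le => x x1.
by rewrite (le_trans (fM x))// ler_piMr.
Qed.

Lemma bounded_linear_continuous_linear (g : X -> Y) (M : R) : linear g ->
  (forall x, `|g x| <= M * `|x|) -> exists f, f = g :> (X -> Y).
Proof.
move=> lg gM.
pose l : {linear X -> Y} := HB.pack g (GRing.isLinear.Build _ _ _ _ _ lg).
have cg : g \in continuous_linear_pred.
  apply/asboolP; split=> //.
  apply: (@bounded_linear_continuous _ _ _ l); apply/linear_boundedP.
  exists M; split=> [|r /ltW Mr x]; first exact: num_real.
  by rewrite (le_trans (gM x))// ler_wpM2r.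
by exists (ContinuousLinear cg).
Qed.

End ContinuousLinear.

Section Separation.
Context {R : realType} {X : normedModType R}.

Lemma sublinear_norm : sublinear (fun x : X => `|x|).
Proof.
by split=> [u v|t v t0]; [exact: ler_normD|rewrite normrZ ger0_norm].
Qed.

(** With [A] a singleton this yields norming functionals; with [A = [set x - c | c in C]] it
separates [x] from [C]. *)
Lemma dual_separation (A : set X) (d : R) : A !=set0 -> convex_set A ->
  (forall a, A a -> d <= `|a|) ->
  exists psi : dual X, `|psi| <= 1 /\ forall a, A a -> d <= psi a.
Proof.
move=> A0 cA dA.
have [f [lf f_le df]] := hahn_banach_sandwich sublinear_norm A0 cA dA.
have fN v : f (- v) = - f v.
  have := lf (-1) v 0; have := lf 1 0 0.
  rewrite scaleN1r !scale1r !addr0 => f00 ->.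
  have -> : f 0 = 0 by have : f 0 = f 0 + f 0 := f00; lra.
  by rewrite addr0 scaleN1r.
have f_norm v : `|f v : R^o| <= 1 * `|v|.
  by rewrite mul1r ler_norml f_le andbT lerNl -fN -(normrN v) f_le.
have [psi psiE] := bounded_linear_continuous_linear lf f_norm.
exists psi; split=> [|a Aa]; last by rewrite psiE df.
by apply: opnorm_le_bound => // v; rewrite psiE.
Qed.

Lemma dual_norming (x : X) : exists psi : dual X, `|psi| <= 1 /\ `|x| <= psi x.
Proof.
have [||a ->//|psi [psi1 h]] := @dual_separation [set x] `|x|.
- by exists x.
- by move=> a b l; rewrite !inE => -> ->; rewrite convmm.
by exists psi; split=> //; exact: h.
Qed.

Lemma closed_dist (C : set X) (x : X) : closed C -> ~ C x ->
  exists2 d : R, 0 < d & forall c, C c -> d <= `|x - c|.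
Proof.
move=> /closed_openC/[swap] nCx oC.
have /nbhs_ballP[d /= d0 dC] : nbhs x (~` C) by exact: open_nbhs_nbhs.
exists d => // c Cc; rewrite leNgt; apply/negP => xc.
by apply: (dC c) Cc; rewrite -ball_normE.
Qed.

(** Mazur's lemma along an arbitrary filter: a functional separating [x] from [C] by [d > 0]
stays at distance [d] from its value at [x] along [u]. *)
Lemma closed_convex_weakly_closed (T : Type) (FF : set_system T)
    {PF : ProperFilter FF} (C : set X) (u : T -> X) (x : X) :
  closed C -> convex_set C -> (\forall k \near FF, C (u k)) ->
  weakly_cvg (u @ FF) x -> C x.
Proof.
move=> clC cC Cu ux; apply: contrapT => nCx.
have [d d0 dC] := closed_dist clC nCx.
have [||_ [c Cc <-]|psi [_ psi_ge]] :=
    @dual_separation [set x - c | c in C] d; last 1 first.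
- have : psi (u k) @[k --> FF] --> (psi x : R^o) := ux psi.
  move=> /cvgrPdist_lt/(_ _ d0) psiu.
  have [k [Cuk]] : exists k, C (u k) /\ `|psi x - psi (u k)| < d.
    by apply: (@filter_ex _ FF); apply: filterI.
  apply/negP; rewrite -leNgt.
  have := psi_ge _ (ex_intro2 _ _ (u k) Cuk erefl); rewrite linearB/=.
  by move=> /le_trans; apply; exact: ler_norm.
- have [k Cuk] := @filter_ex _ FF PF _ Cu.
  by exists (x - u k), (u k).
- move=> a b l; rewrite !inE => -[c Cc <-] [e Ce <-].
  exists (l%:num *: c + (1 - l%:num) *: e).
    by apply: convex_set_conv => //; exact: le1.
  change (x - (l%:num *: c + (1 - l%:num) *: e) =
    l%:num *: (x - c) + (1 - l%:num) *: (x - e)).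
  rewrite !scalerBr addrACA -opprD -scalerDl.
  by rewrite [_ + (1 - _)]addrC subrK scale1r.
- exact: dC.
Qed.

End Separation.

(** * Uniform boundedness and dual spaces *)

Section UniformBoundedness.
Context {R : realType}.

Lemma bounded_setP (V : normedModType R) (A : set V) :
  bounded_set A <-> exists2 M, 0 <= M & forall a, A a -> `|a| <= M.
Proof.
split=> [/pinfty_ex_gt0[M /ltW M0 AM]|[M M0 AM]]; first by exists M.
exists M; split=> [|N /ltW MN a Aa]; first exact: num_real.
exact: le_trans (AM a Aa) MN.
Qed.

Lemma cvg_seq_norm_le (V : normedModType R) (u : nat -> V) (l : V) :
  u @ \oo --> l -> exists2 M, 0 <= M & forall k, `|u k| <= M.
Proof.
move=> ul; have /pinfty_ex_gt0[M /ltW M0 uM] : bounded_fun u.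
  by apply: cvg_seq_bounded; apply/cvg_ex; exists l.
by exists M => // k; exact: uM.
Qed.

(** The pointwise limit of a Cauchy filter is bounded because the filter is eventually
within distance [1] of a single map, and it is the norm limit because the estimate
$\|f x - h x\| \le e\|x\|$ passes to the limit in [h]. *)
Lemma continuous_linear_complete (X : normedModType R)
    (Y : completeNormedModType R) (FF : set_system (continuous_linear X Y)) :
  ProperFilter FF -> cauchy FF -> cvg FF.
Proof.
move=> PF /cauchyP cFF.
have cauchy_ball (e : R) : 0 < e -> exists g, \forall f \near FF, `|g - f| < e.
  by move=> /cFF[g FFg]; exists g; apply: filterS FFg => f; rewrite -ball_normE.
have cvg_pt x : cvg ((fun f : continuous_linear X Y => f x) @ FF).
  apply/cauchy_cvgP/cauchyP => e e0.
  have x0 : 0 < `|x| + 1 by rewrite ltr_wpDl.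
  have [g FFg] := cauchy_ball _ (divr_gt0 e0 x0).
  exists (g x); change (FF [set f : continuous_linear X Y | ball (g x) e (f x)]).
  apply: filterS FFg => f gf; rewrite -ball_normE /=.
  apply: (@le_lt_trans _ _ (`|g - f| * (`|x| + 1))).
    apply: le_trans (ler_opnorm (g - f) x) _.
    by rewrite ler_wpM2l// lerDl.
  by rewrite -ltr_pdivlMr.
pose l x := lim ((fun f : continuous_linear X Y => f x) @ FF).
have fl x : (fun f : continuous_linear X Y => f x) @ FF --> l x := cvg_pt x.
have ll : linear l.
  move=> a u v; apply: (@cvg_unique _ (@norm_hausdorff _ _) _ _ _ _ (fl _)).
  have -> : (fun f : continuous_linear X Y => f (a *: u + v)) =
            (fun f => a *: f u + f v) by apply/funext => f; rewrite linearP.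
  by apply: cvgD (fl v); apply: cvgZr; exact: fl.
have l_near (e : R) : 0 < e ->
    FF [set f : continuous_linear X Y | forall x, `|f x - l x| <= e * `|x|].
  move=> e0; have [g FFg] := cauchy_ball (e / 2) (divr_gt0 e0 (ltr0Sn R 1)).
  apply: filterS (FFg) => f gf x.
  have fx : (fun h : continuous_linear X Y => `|f x - h x|) @ FF --> `|f x - l x|.
    by apply: cvg_norm; apply: cvgB (fl x); exact: cvg_cst.
  apply: (cvgr_to_le fx).
  apply: filterS FFg => h gh /=.
  apply: le_trans (ler_opnorm (f - h) x) _; rewrite ler_wpM2r//.
  have -> : f - h = (g - h) - (g - f) by rewrite opprB [RHS]addrC addrA subrK.
  by rewrite (le_trans (ler_normB _ _))// (splitr e) lerD// ltW.
have [g gl] := @filter_ex _ FF _ _ (l_near 1 ltr01).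
have [h hl] : exists h : continuous_linear X Y, h = l :> (X -> Y).
  apply: (@bounded_linear_continuous_linear _ _ _ l (`|g| + 1)) => // x.
  rewrite -[l x](subrK (g x)) mulrDl addrC mul1r.
  rewrite (le_trans (ler_normD _ _))// lerD ?ler_opnorm// distrC.
  by rewrite -[leRHS]mul1r.
apply/cvg_ex; exists h; apply/cvgrPdist_le => e e0.
apply: filterS (l_near e e0) => f fle.
rewrite distrC; apply: opnorm_le_bound; first exact: ltW.
by move=> x; change (`|f x - h x| <= e * `|x|); rewrite hl; exact: fle.
Qed.

HB.instance Definition _ (X : normedModType R) (Y : completeNormedModType R) :=
  Uniform_isComplete.Build (continuous_linear X Y)
    (@continuous_linear_complete X Y).

(** Banach-Steinhaus in terms of operator norms. *)
Lemma uniform_boundedness (X : completeNormedModType R) (Y : normedModType R)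
    (T : Type) (A : set T) (f : T -> continuous_linear X Y) :
  (forall x, exists M, forall t, A t -> `|f t x| <= M) ->
  exists2 M, 0 <= M & forall t, A t -> `|f t| <= M.
Proof.
move=> f_pt.
have [||M fM] := @Banach_Steinhauss _ X Y [set (f t : X -> Y) | t in A] _ _ 1.
- move=> _ [t At <-]; split; last exact: linearP.
  move=> r; exists (`|f t| * r) => x xr.
  by rewrite (le_trans (ler_opnorm _ _))// ler_wpM2l.
- move=> x; have [M fM] := f_pt x.
  by exists M => _ [t At <-]; exact: fM.
exists `|M| => // t At; apply: opnorm_le => x x1.
by apply: le_trans (fM (f t) _ x x1) (ler_norm M); exists t.
Qed.

(** Points of X are functionals on dual X *)
(** The canonical embedding into the bidual does not decrease the norm, thanks to a norming
functional. *)
Lemma evaluation (X : normedModType R) (x : X) :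
  exists ev : continuous_linear (dual X) R^o,
    (forall psi, ev psi = psi x) /\ `|x| <= `|ev|.
Proof.
have [|psi|ev evE] := @bounded_linear_continuous_linear _ (dual X) R^o
    (fun psi => psi x) `|x|.
- by [].
- by rewrite mulrC ler_opnorm.
exists ev; split=> [psi|]; first by rewrite evE.
have [psi [psi1 xpsi]] := dual_norming x.
apply: le_trans xpsi _; have -> : psi x = ev psi by rewrite evE.
apply: le_trans (ler_norm _) _; apply: le_trans (ler_opnorm _ _) _.
by rewrite ler_piMr.
Qed.

(** The [u k], seen as functionals on the complete space [dual X], are pointwise bounded. *)
Lemma weakly_cvg_bounded (X : normedModType R) (u : nat -> X) (x : X) :
  weakly_cvg (u @ \oo) x -> exists2 M, 0 <= M & forall k, `|u k| <= M.
Proof.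
move=> ux; have /choice[ev evE] := fun k => evaluation (u k).
have [|M M0 evM] :=
    @uniform_boundedness (dual X : completeNormedModType R) R^o nat setT ev.
  move=> psi; have [M _ uM] := cvg_seq_norm_le (ux psi : (psi \o u) @ \oo --> _).
  by exists M => k _; rewrite (evE k).1; exact: uM.
by exists M => // k; rewrite (le_trans (evE k).2)// evM.
Qed.

End UniformBoundedness.

(** * Projection onto closed convex sets in Hilbert spaces *)

Section Hilbert.
Context {R : realType} {H : normedModType R} (ip : inner_product H).
Implicit Types u v w z p : H.

Lemma ipDl u v w : ip (u + v) w = ip u w + ip v w.
Proof. by rewrite linearDl. Qed.

Lemma ipDr u v w : ip w (u + v) = ip w u + ip w v.
Proof. by rewrite linearD. Qed.

Lemma ipZr (a : R) u v : ip u (a *: v) = a * ip u v.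
Proof. by rewrite linearZ. Qed.

Lemma ipZl (a : R) u v : ip (a *: u) v = a * ip u v.
Proof. by rewrite inner_productC ipZr inner_productC. Qed.

Lemma ipNr u v : ip u (- v) = - ip u v.
Proof. by rewrite linearN. Qed.

Lemma ipNl u v : ip (- u) v = - ip u v.
Proof. by rewrite inner_productC ipNr inner_productC. Qed.

Lemma sqr_normD u v : `|u + v| ^+ 2 = `|u| ^+ 2 + ip u v *+ 2 + `|v| ^+ 2.
Proof.
rewrite -!(inner_product_norm ip) ipDl !ipDr (inner_productC ip v u); ring.
Qed.

Lemma sqr_normB u v : `|u - v| ^+ 2 = `|u| ^+ 2 - ip u v *+ 2 + `|v| ^+ 2.
Proof. by rewrite sqr_normD ipNr normrN mulNrn. Qed.

Lemma parallelogram u v :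
  `|u - v| ^+ 2 = `|u| ^+ 2 *+ 2 + `|v| ^+ 2 *+ 2 - `|2^-1 *: (u + v)| ^+ 2 *+ 4.
Proof.
rewrite normrZ exprMn sqr_normB sqr_normD ger0_norm ?invr_ge0//.
by field.
Qed.

Definition nearest (S : set H) z p := S p /\ forall q, S q -> `|z - p| <= `|z - q|.

(** Moving from [p] towards [s] by a fraction [t] changes the squared distance to [z] by
$-2t(z-p,s-p) + t^2\|s-p\|^2$, which is negative for small [t] if the angle is acute. *)
Lemma nearest_obtuse (S : set H) z p s : convex_set S -> nearest S z p -> S s ->
  ip (z - p) (s - p) <= 0.
Proof.
move=> cS [Sp pmin] Ss; rewrite leNgt; apply/negP.
set a : R := ip _ _; set b : R := `|s - p| ^+ 2 => a0.
have b0 : 0 <= b by rewrite exprn_ge0.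
have ab : 0 < a + b by rewrite ltr_wpDr.
(* Here $t(a + b) = a$, so that $t^2 b \le ta < 2ta$, and $t \le 1$. *)
pose t := a / (a + b).
have t0 : 0 < t by rewrite divr_gt0.
have t1 : t <= 1 by rewrite ler_pdivrMr// mul1r lerDl.
have := pmin _ (convex_set_conv cS (ltW t0) t1 Ss Sp).
have -> : z - (t *: s + (1 - t) *: p) = (z - p) - t *: (s - p).
  by rewrite scalerBl scale1r addrCA -scalerBr opprD addrA.
rewrite -ler_sqr ?nnegrE// (sqr_normB (z - p)) ipZr -/a normrZ exprMn -/b (ger0_norm (ltW t0)).
move=> h.
have tb : t * (t * b) <= t * a.
  rewrite ler_pM2l// /t mulrAC ler_pdivrMr// ler_pM2l//.
  by rewrite lerDr ltW.
have : 0 < t * a by rewrite mulr_gt0.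
have {h} : 0 <= - (t * a *+ 2) + t * (t * b).
  by rewrite mulrA -expr2 -(lerD2l (`|z - p| ^+ 2)) addr0 addrA.
lra.
Qed.

Lemma nearest_nonexpansive (S : set H) z z' p p' : convex_set S ->
  nearest S z p -> nearest S z' p' -> `|p - p'| <= `|z - z'|.
Proof.
move=> cS np np'.
have h1 := nearest_obtuse cS np np'.1.
have h2 := nearest_obtuse cS np' np.1.
have h3 : `|p - p'| ^+ 2 <= ip (z - z') (p - p').
  rewrite -(inner_product_norm ip) -subr_ge0.
  have -> : ip (z - z') (p - p') - ip (p - p') (p - p') =
      - (ip (z - p) (p' - p) + ip (z' - p') (p - p')).
    rewrite -(opprB p p') (ipNr _ (p - p')) !(ipDl, ipNl); ring.
  by lra.
have := le_trans h3 (inner_product_le ip _ _).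
have [->|pp'] := eqVneq (p - p') 0; first by rewrite normr0.
by rewrite expr2 ler_pM2r// normr_gt0.
Qed.

End Hilbert.

Section Projection.
Context {R : realType} {H : completeNormedModType R} (ip : inner_product H).

(** The parallelogram law makes a minimising sequence Cauchy, the midpoint of two of its
terms being again in [S]. *)
Lemma nearest_exists (S : set H) (z : H) : S !=set0 -> closed S -> convex_set S ->
  exists p, nearest S z p.
Proof.
move=> [s0 Ss0] clS cS.
pose D := [set `|z - q| ^+ 2 | q in S].
have Dinf : has_inf D.
  split; first by exists (`|z - s0| ^+ 2), s0.
  by exists 0 => _ [q _ <-]; rewrite exprn_ge0.
pose d := inf D.
have d_le q : S q -> d <= `|z - q| ^+ 2.
  by move=> Sq; apply: ge_inf; [case: Dinf|exists q].
have /choice[q qP] : forall n : nat, exists q, S q /\ `|z - q| ^+ 2 < d + n.+1%:R^-1.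
  move=> n; have [|_ [q Sq <-] qd] := @inf_adherent _ D n.+1%:R^-1 _ Dinf.
    by rewrite invr_gt0.
  by exists q.
have q_close m n : (m <= n)%N -> `|q m - q n| ^+ 2 <= 4 * m.+1%:R^-1.
  move=> mn; have [[Sm qm] [Sn qn]] := (qP m, qP n).
  have -> : q m - q n = (z - q n) - (z - q m).
    by rewrite opprB [RHS]addrC addrA subrK.
  rewrite (parallelogram ip).
  have -> : 2^-1 *: (z - q n + (z - q m)) =
            z - (2^-1 *: q n + (1 - 2^-1) *: q m).
    have -> : 1 - 2^-1 = 2^-1 :> R by field.
    rewrite -scalerDr addrACA -opprD scalerBr; congr (_ - _).
    by rewrite -mulr2n -[z *+ 2]scaler_nat scalerA mulVf// scale1r.
  have mid : S (2^-1 *: q n + (1 - 2^-1) *: q m).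
    apply: convex_set_conv => //.
    by rewrite invf_le1// ler1n.
  have := d_le _ mid; set A := `|z - (_ + _)| ^+ 2 => dA.
  have : n.+1%:R^-1 <= m.+1%:R^-1 :> R by rewrite lef_pV2 ?posrE// ler_nat.
  move: qm qn dA; move: A (`|z - q m| ^+ 2) (`|z - q n| ^+ 2) => A qm2 qn2.
  move: (m.+1%:R^-1) (n.+1%:R^-1) => mi ni; lra.
have cq : cauchy (q @ \oo).
  apply/cauchyP => e e0.
  have [N _ Ne] : \forall n \near \oo, (n.+1%:R^-1 : R) < e ^+ 2 / 4.
    exact: (near_infty_natSinv_lt (PosNum (divr_gt0 (exprn_gt0 2 e0) (ltr0Sn R 3)))).
  exists (q N); exists N => // n /= Nn; rewrite -ball_normE /=.
  rewrite -ltr_sqr ?nnegrE ?(ltW e0)//; apply: le_lt_trans (q_close _ _ Nn) _.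
  by rewrite -ltr_pdivlMl// mulrC; apply: Ne => /=.
pose p := lim (q @ \oo).
have qp : q @ \oo --> p by apply: cauchy_cvg.
exists p; split.
  have Sq : \forall n \near \oo, S (q n) by apply: nearW => n; case: (qP n).
  exact: (closed_cvg S clS Sq p qp).
move=> s Ss; rewrite -ler_sqr ?nnegrE//; apply: le_trans (d_le _ Ss).
have zq : (fun n => `|z - q n| ^+ 2) @ \oo --> `|z - p| ^+ 2.
  have zqp : (fun n => `|z - q n|) @ \oo --> `|z - p|.
    by apply: cvg_norm; apply: cvgB qp; exact: cvg_cst.
  by rewrite expr2; under eq_fun do rewrite expr2; exact: (cvgM zqp zqp).
apply/ler_addgt0Pr => e e0.
apply: (cvgr_to_le zq).
have := near_infty_natSinv_lt (PosNum e0); apply: filterS => n /= ne.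
by rewrite ltW// (lt_trans (qP n).2)// ltrD2l.
Qed.

Lemma metric_projection_nearest (S : set H) (z : H) :
  S !=set0 -> closed S -> convex_set S -> nearest S z (metric_projection S z).
Proof.
move=> S0 clS cS; apply: (@getPex _ (nearest S z)).
exact: nearest_exists.
Qed.

End Projection.

(** * Weak convergence *)

Section WeakConvergence.
Context {R : realType}.

Lemma weakly_cvg_linear (X Z : normedModType R) (L : continuous_linear X Z)
    (T : Type) (F : set_system T) (u : T -> X) (x : X) :
  weakly_cvg (u @ F) x -> weakly_cvg ((L \o u) @ F) (L x).
Proof. by move=> ux psi; exact: (ux (adjoint L psi)). Qed.

Lemma weakly_cvg_pair (X Z : normedModType R) (T : Type) (F : set_system T)
    {FF : Filter F} (u : T -> X) (v : T -> Z) (x : X) (z : Z) :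
  weakly_cvg (u @ F) x -> weakly_cvg (v @ F) z ->
  weakly_cvg ((fun k => (u k, v k)) @ F) (x, z).
Proof.
move=> ux vz psi.
have [c a b|a|i1 i1E] := @bounded_linear_continuous_linear R X (X * Z)%type
    (fun a => (a, 0)) 1.
- by congr (_, _); rewrite /= scaler0 addr0.
- by rewrite mul1r prod_normE /= normr0 max_l.
have [c a b|a|i2 i2E] := @bounded_linear_continuous_linear R Z (X * Z)%type
    (fun b => (0, b)) 1.
- by congr (_, _); rewrite /= scaler0 addr0.
- by rewrite mul1r prod_normE /= normr0 max_r.
have psiE a b : psi (a, b) = psi (i1 a) + psi (i2 b).
  rewrite -linearD i1E i2E; congr (psi _).
  by congr (_, _); rewrite /= ?addr0 ?add0r.
change (psi (u k, v k) @[k --> F] --> psi (x, z)).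
under eq_fun do rewrite psiE.
have h1 : psi (i1 (u k)) @[k --> F] --> psi (i1 x) :=
  @weakly_cvg_linear X _ i1 T F u x ux psi.
have h2 : psi (i2 (v k)) @[k --> F] --> psi (i2 z) :=
  @weakly_cvg_linear Z _ i2 T F v z vz psi.
rewrite psiE; exact: (cvgD h1 h2).
Qed.

Lemma weakly_cvg_seq_cst (X : normedModType R) (x : X) :
  weakly_cvg ((fun _ : nat => x) @ \oo) x.
Proof. by move=> psi; exact: cvg_cst. Qed.

(** For a fixed small [t], $T(v + t h_k) \to T(v)$ when $h_k$ converges weakly to [0], and
$T(v + t h_k) - T(v) - t D h_k$ is small compared with [t], uniformly in [k] since $h_k$
is bounded; so $\|D h_k\|$ is eventually as small as one likes. *)
Lemma completely_continuous_derivative (X Y : normedModType R) (T : X -> Y)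
    (D : continuous_linear X Y) (v : X) :
  is_diff v T D -> completely_continuous T -> completely_continuous D.
Proof.
move=> [dT dTE] cT u u0 uu0.
pose h k := u k - u0.
suff : D (h k) @[k --> \oo] --> 0.
  move=> Dh; rewrite -[D u0]addr0.
  have -> : (fun k => D (u k)) = (fun k => D u0 + D (h k)).
    by apply/funext => k; rewrite linearB addrC subrK.
  by apply: cvgD Dh; exact: cvg_cst.
have h0 : weakly_cvg (h @ \oo) 0.
  move=> psi; change (psi (u k - u0) @[k --> \oo] --> psi 0).
  rewrite -(subrr u0) linearB; under eq_fun do rewrite linearB.
  by apply: cvgB; [exact: uu0|exact: cvg_cst].
have [M M0 hM] := weakly_cvg_bounded h0.
have M1 : 0 < M + 1 by rewrite ltr_wpDl.
apply/cvgr0Pnorm_le => e e0.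
pose e' := e / (2 * (M + 1)).
have e'0 : 0 < e' by rewrite divr_gt0// mulr_gt0.
have : \forall w \near (0 : X), `|T (w + v) - T v - D w| <= e' * `|w|.
  have /diff_locally/eqaddoP/(_ e' e'0) := dT; rewrite dTE.
  by apply: filterS => w; rewrite /= opprD addrA.
move=> /nbhs_ballP[d /= d0 dP].
(* The step [t] brings every [t *: h k] into the ball of radius [d]. *)
pose t := d / (2 * (M + 1)).
have t0 : 0 < t by rewrite divr_gt0// mulr_gt0.
have Tt : T (t *: h k + v) @[k --> \oo] --> T v.
  apply: (cT (fun k => t *: h k + v) v) => psi.
  have -> : psi v = t * psi 0 + psi v by rewrite linear0 mulr0 add0r.
  change (psi (t *: h k + v) @[k --> \oo] --> (t * psi 0 + psi v : R^o)).
  under eq_fun do rewrite linearP.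
  apply: cvgD; last exact: cvg_cst.
  by apply: cvgZr; exact: h0.
have te0 : 0 < t * (e / 2) by rewrite mulr_gt0// divr_gt0.
move/cvgrPdist_le : Tt => /(_ _ te0); apply: filterS => k Tk.
have th : ball 0 d (t *: h k).
  rewrite -ball_normE /= sub0r normrN normrZ gtr0_norm//.
  apply: (@le_lt_trans _ _ (t * (M + 1))).
    by rewrite ler_wpM2l ?(ltW t0)// (le_trans (hM k))// lerDl.
  rewrite /t invfM -!mulrA mulVf ?gt_eqF// mulr1.
  by rewrite ltr_pdivrMr// ltr_pMr// ltr1n.
have := dP _ th; set w := t *: h k => Dw.
have : `|D w| <= t * (e / 2) + e' * `|w|.
  rewrite -normrN -(subrK (T v - T (w + v)) (- D w)).
  rewrite (le_trans (ler_normD _ _))// addrC lerD// opprB.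
  by rewrite addrC.
rewrite /w linearZ /= normrZ gtr0_norm// normrZ gtr0_norm//.
have : e' * (t * `|h k|) <= t * (e / 2).
  rewrite mulrCA ler_pM2l// /e'.
  have -> : e / (2 * (M + 1)) * `|h k| = e / 2 * (`|h k| / (M + 1)).
    by rewrite invfM -!mulrA; congr (_ * (_ * _)); rewrite mulrC.
  rewrite ler_piMr ?divr_ge0 ?(ltW e0)// ler_pdivrMr// mul1r.
  by rewrite (le_trans (hM k))// lerDl.
move=> h1 h2; rewrite -(ler_pM2l t0) (le_trans h2)//.
by rewrite [in leRHS](splitr e) mulrDr lerD2l.
Qed.

Lemma limn_esup_le (f : nat -> R) (c : R) :
  (forall e, 0 < e -> \forall k \near \oo, f k <= c + e) ->
  (limn_esup (fun k => (f k)%:E) <= c%:E)%E.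
Proof.
move=> fc; apply/lee_addgt0Pr => e e0.
apply: (@le_trans _ _ (ereal_sup ((fun k => (f k)%:E) @` [set k | f k <= c + e]))).
  by apply: ereal_inf_lbound; exists [set k | f k <= c + e] => //; exact: fc.
apply: ge_ereal_sup => _ [k /= fk <-].
by rewrite -EFinD lee_fin.
Qed.

(** How pseudomonotonicity is used: only upper bounds for the two pairings are known, and
only their limits matter. *)
Lemma pseudomonotone_le (X : normedModType R) (T : X -> dual X) (u : nat -> X)
    (x y : X) (a b : nat -> R) (b0 : R) :
  pseudomonotone T -> weakly_cvg (u @ \oo) x ->
  (forall k, T (u k) (u k - x) <= a k) -> a @ \oo --> 0 ->
  (forall k, T (u k) (u k - y) <= b k) -> b @ \oo --> b0 ->
  T x (x - y) <= b0.
Proof.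
move=> psT ux Ta a0 Tb bb0.
have sup_le (f g : nat -> R) (c : R) : (forall k, f k <= g k) -> g @ \oo --> c ->
    (limn_esup (fun k => (f k)%:E) <= c%:E)%E.
  move=> fg gc; apply: limn_esup_le => e e0.
  move/cvgrPdist_le : gc => /(_ _ e0); apply: filterS => k.
  rewrite distrC => /(le_trans (ler_norm _)); have := fg k; lra.
rewrite -lee_fin; apply: le_trans (psT _ _ ux (sup_le _ _ _ Ta a0) y) _.
by apply: le_trans (limn_einf_sup _) (sup_le _ _ _ Tb bb0).
Qed.

End WeakConvergence.

(** * Penalty parameters, subsequences and weak-* accumulation points *)

Section Sequences.
Context {R : realType}.

(** If the test fails infinitely often, each failure adds at least
$(\gamma - 1)\rho_0$ to the nondecreasing sequence [rho]. *)
Lemma penalty_dichotomy (rho V : nat -> R) (gamma tau : R) :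
  0 < rho 0%N -> 1 < gamma -> 0 < tau < 1 -> (forall k, 0 <= V k) ->
  (forall k, rho k.+1 = if (k == 0%N) || (V k <= tau * V k.-1)
                        then rho k else gamma * rho k) ->
  (forall k, rho 0%N <= rho k) /\
  (V @ \oo --> 0 \/ (fun k => (rho k)^-1) @ \oo --> 0).
Proof.
move=> rho0 gamma1 /andP[tau0 tau1] V0 rhoS.
have rho_ge k : rho 0%N <= rho k /\ rho k <= rho k.+1.
  have step j : rho 0%N <= rho j -> rho j <= rho j.+1.
    move=> jrho; rewrite rhoS; case: ifP => // _.
    by rewrite ler_peMl ?(ltW gamma1)// (le_trans (ltW rho0)).
  suff h : rho 0%N <= rho k by split=> //; exact: step.
  by elim: k => // k IH; rewrite (le_trans IH)// step.
have rho_mono : {homo rho : m n / (m <= n)%N >-> m <= n}.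
  by apply: homo_leq => [//|? ? ?|k]; [exact: le_trans|case: (rho_ge k)].
split=> [k|]; first by case: (rho_ge k).
have [[N VN]|notN] :=
    pselect (exists N, forall k, (N <= k)%N -> V k.+1 <= tau * V k); [left|right].
  have Vgeo n : V (n + N)%N <= V N * tau ^+ n.
    elim: n => [|n IH]; first by rewrite add0n expr0 mulr1.
    rewrite addSn (le_trans (VN _ (leq_addl _ _)))// exprS mulrCA.
    by rewrite ler_wpM2l// ltW.
  rewrite -(cvg_shiftn N); apply: (@squeeze_cvgr _ _ _ _ (cst 0) (geometric (V N) tau)).
  - by apply: nearW => n; rewrite V0 Vgeo.
  - exact: cvg_cst.
  - by apply: cvg_geometric; rewrite ger0_norm// ltW.
have jump N : exists2 k, (N <= k)%N & rho k.+1 = gamma * rho k.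
  apply: contrapT => nex; apply: notN; exists N => k Nk.
  rewrite leNgt; apply/negP => Vk; apply: nex.
  exists k.+1; first exact: leqW.
  by rewrite rhoS /= leNgt Vk.
pose c := (gamma - 1) * rho 0%N.
have c0 : 0 < c by rewrite mulr_gt0// subr_gt0.
have grow m : exists N, m%:R * c <= rho N.
  elim: m => [|m [N IH]]; first by exists 0%N; rewrite mul0r ltW.
  have [k Nk rhok] := jump N; exists k.+1.
  rewrite rhok -natr1 mulrDl mul1r.
  have -> : gamma * rho k = rho k + (gamma - 1) * rho k by rewrite mulrBl mul1r addrC subrK.
  apply: lerD; first exact: le_trans IH (rho_mono _ _ Nk).
  by rewrite ler_pM2l ?subr_gt0//; case: (rho_ge k).
apply/cvgr0Pnorm_le => e e0.
have [m mc] : exists m : nat, (e * c)^-1 <= m%:R.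
  by exists (Num.truncn (e * c)^-1).+1; exact: ltW (truncnS_gt _).
have [N Nm] := grow m.
exists N => // k /= Nk.
have rk : 0 < rho k by rewrite (lt_le_trans rho0)//; case: (rho_ge k).
rewrite ger0_norm ?invr_ge0 ?(ltW rk)//.
rewrite -[e]invrK lef_pV2 ?posrE ?invr_gt0//.
apply: le_trans (rho_mono _ _ Nk); apply: le_trans Nm.
by rewrite -ler_pdivrMr// -invfM.
Qed.

Lemma infinite_set_unbounded (I : set nat) (N : nat) : infinite_set I ->
  exists2 k, I k & (N <= k)%N.
Proof.
move=> infI; apply: contrapT => nex; apply: infI.
apply: (@sub_finite_set _ _ `I_N); last exact: finite_II.
move=> k Ik /=; rewrite ltnNge; apply/negP => Nk; apply: nex.
by exists k.
Qed.

Lemma within_infinite_proper (I : set nat) : infinite_set I ->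
  ProperFilter (within I \oo).
Proof.
move=> infI; split; last exact: within_filter.
move=> [N _ NI]; have [k Ik Nk] := infinite_set_unbounded N infI.
exact: (NI k Nk).
Qed.

(** The selected indices satisfy $s_n \ge n$; they need not increase, convergence of [s] to
infinity within [I] being all that subsequence arguments require. *)
Lemma subsequence_within (I : set nat) (P : nat -> nat -> Prop) :
  (forall n, exists k, [/\ I k, (n <= k)%N & P n k]) ->
  exists s : nat -> nat, (forall n, I (s n) /\ P n (s n)) /\ s @ \oo --> within I \oo.
Proof.
move=> /choice[s sP]; exists s; split=> [n|A [N _ NA]]; first by case: (sP n).
exists N => // n /= Nn; have [Is ns _] := sP n.
by apply: NA => //=; exact: leq_trans ns.
Qed.

(** Evaluation at [v] is weak-* continuous, so an accumulation point is approximated at [v]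
by terms with index in any prescribed set of the filter. *)
Lemma weak_star_accumulation_approx (Y : normedModType R) (T : Type)
    (F : set_system T) {FF : Filter F} (mu : T -> dual Y) (l : dual Y) (A : set T) (v : Y) (e : R) :
  weak_star_accumulation_points (mu @ F) l -> F A -> 0 < e ->
  exists2 k, A k & `|l v - mu k v| < e.
Proof.
move=> cl FA e0.
pose W := weak_star_topology Y.
have Wv : nbhs (l : W) [set psi : W | `|l v - (psi : dual Y) v| < e].
  have ev : {for (l : W), continuous (fun psi : W => (psi : dual Y) v : R^o)}.
    apply: (@continuous_comp W {ptws Y -> R^o} R^o
      (fun psi => (psi : dual Y) : {ptws Y -> R^o}) (fun f => f v)).
      exact: initial_continuous.
    exact: (@proj_continuous Y (fun=> R^o) v).
  by move/cvgrPdist_lt : ev => /(_ _ e0).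
have [|_ [[k Ak <-] ?]] := cl (mu @` A) _ _ Wv; last by exists k.
change (F [set k | (mu @` A) (mu k)]).
by apply: filterS FA => k Ak; exists k.
Qed.

End Sequences.

(** * Limits along an infinite set of indices *)

Section WithinSubsequence.
Context {R : realType} (I : set nat).

(** Complete continuity and boundedness of weakly convergent sequences concern full
sequences; filling the indices outside [I] with the limit transfers them to [I]. *)
Lemma weakly_cvg_extension (X : normedModType R) (u : nat -> X) (x : X) :
  weakly_cvg (u k @[k --> within I \oo]) x ->
  weakly_cvg ((fun k => if `[< I k >] then u k else x) @ \oo) x.
Proof.
move=> ux psi; apply/cvgrPdist_lt => e e0.
have /cvgrPdist_lt/(_ _ e0) := ux psi.
change (\oo [set k | I k -> `|psi x - psi (u k)| < e] ->
  \oo [set k | `|psi x - psi (if `[< I k >] then u k else x)| < e]).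
apply: filterS => k /=; case: asboolP => [Ik /(_ Ik)//|_ _].
by rewrite subrr normr0.
Qed.

Lemma weakly_cvg_within_bounded (X : normedModType R) (u : nat -> X) (x : X) :
  weakly_cvg (u k @[k --> within I \oo]) x ->
  exists2 M, 0 <= M & forall k, I k -> `|u k| <= M.
Proof.
move=> /weakly_cvg_extension/weakly_cvg_bounded[M M0 uM].
by exists M => // k /asboolT Ik; have := uM k; rewrite Ik.
Qed.

Lemma completely_continuous_within (Z W : normedModType R) (T : Z -> W)
    (u : nat -> Z) (z : Z) : completely_continuous T ->
  weakly_cvg (u k @[k --> within I \oo]) z ->
  T (u k) @[k --> within I \oo] --> T z.
Proof.
move=> cT /weakly_cvg_extension/cT Tu; apply/cvgrPdist_lt => e e0.
move/cvgrPdist_lt : Tu => /(_ _ e0).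
change (\oo [set k | `|T z - T (if `[< I k >] then u k else z)| < e] ->
  \oo [set k | I k -> `|T z - T (u k)| < e]).
by apply: filterS => k /= Tu /asboolT Ik; move: Tu; rewrite Ik.
Qed.

End WithinSubsequence.

Section Limits.
Context {R : realType} {T : Type} (F : set_system T) {FF : ProperFilter F}.

Lemma squeeze_norm (V : normedModType R) (u : T -> V) (l : V) (e : T -> R) :
  (\forall k \near F, `|u k - l| <= e k) -> e @ F --> 0 -> u @ F --> l.
Proof.
move=> ule e0; apply/cvgrPdist_le => d d0.
move/cvgr0Pnorm_le : e0 => /(_ _ d0); apply: filterS2 ule => k ule.
by rewrite distrC => ed; rewrite (le_trans ule)// (le_trans (ler_norm _)).
Qed.

(** The limit operator [D0] may improve the convergence of [u] (here, from weak to strong), so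
only [D0 \o u], not [u], is asked to converge. *)
Lemma cvg_operator_apply (X Y : normedModType R)
    (D : T -> continuous_linear X Y) (D0 : continuous_linear X Y) (u : T -> X)
    (y : Y) (M : R) :
  D @ F --> D0 -> (\forall k \near F, `|u k| <= M) -> D0 (u k) @[k --> F] --> y ->
  D k (u k) @[k --> F] --> y.
Proof.
move=> DD0 uM D0u.
have -> : (fun k => D k (u k)) = (fun k => (D k - D0) (u k) + D0 (u k)).
  by apply/funext => k; change (D k (u k) = D k (u k) - D0 (u k) + D0 (u k));
    rewrite subrK.
rewrite -[y]add0r; apply: cvgD D0u.
apply: (@squeeze_norm _ _ _ (fun k => `|D k - D0| * M)).
  apply: filterS uM => k uM; rewrite subr0.
  by apply: le_trans (ler_opnorm _ _) _; rewrite ler_wpM2l.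
rewrite -(mul0r M); apply: cvgM; last exact: cvg_cst.
rewrite -(normr0 (continuous_linear X Y)); apply: cvg_norm.
by rewrite -(subrr D0); apply: cvgB DD0 _; exact: cvg_cst.
Qed.

Lemma cvg_continuous_linear (X Y : normedModType R) (L : continuous_linear X Y)
    (u : T -> X) (l : X) : u @ F --> l -> L (u k) @[k --> F] --> L l.
Proof.
move=> ul; change ((L \o u) @ F --> L l).
by apply: cvg_comp ul _; exact: continuous_linear_continuous.
Qed.

Lemma cvg_inner_product (H : normedModType R) (ip : inner_product H)
    (u v : T -> H) (u0 v0 : H) :
  u @ F --> u0 -> v @ F --> v0 -> ip (u k) (v k) @[k --> F] --> ip u0 v0.
Proof.
have polar a b : ip a b = 2^-1 * (`|a + b| * `|a + b| - `|a| * `|a| - `|b| * `|b|).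
  by rewrite -!expr2 (sqr_normD ip); field.
move=> uu vv; rewrite polar; under eq_fun do rewrite polar.
apply: cvgM; first exact: cvg_cst.
have nuv : `|u k + v k| @[k --> F] --> `|u0 + v0|.
  by apply: cvg_norm; exact: (cvgD uu vv).
have nu : `|u k| @[k --> F] --> `|u0| by exact: cvg_norm.
have nv : `|v k| @[k --> F] --> `|v0| by exact: cvg_norm.
exact: (cvgB (cvgB (cvgM nuv nuv) (cvgM nu nu)) (cvgM nv nv)).
Qed.

End Limits.

(** * Boundedness of multipliers under a constraint qualification *)

Section MultiplierBound.
Context {R : realType} {X : normedModType R} {Y : completeNormedModType R}.

Lemma lower_bound_arith (m1 m2 n M q a1 a2 a3 a4 a5 : R) :
  - (1 * q) <= a1 -> - ((n + `|M|) * q) <= a4 -> - (1 * q) <= a5 ->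
  m1 <= a3 -> a2 <= m2 -> 0 <= q -> 0 <= n ->
  - ((`|m1| + `|m2| + (2 + (n + `|M|))) * (1 + q)) <= a1 - a2 + a3 + a4 + a5.
Proof.
move=> h1 h2 h3 h4 h5 q0 n0.
have := ler_norm (- m1); have := ler_norm m2; rewrite normrN.
have : 0 <= (`|m1| + `|m2|) * q by rewrite mulr_ge0// addr_ge0.
have := normr_ge0 M.
move: `|m1| `|m2| `|M| h1 h2 h3 => n1 n2 n3; lra.
Qed.

Lemma cvg_norm_sub0 (V : normedModType R) (T : Type) (F : set_system T)
    {FF : Filter F} (u : T -> V) (l : V) :
  u @ F --> l -> `|l - u k| @[k --> F] --> 0.
Proof.
move=> ul; rewrite -(normr0 V); apply: cvg_norm; rewrite -(subrr l).
by apply: cvgB ul; exact: cvg_cst.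
Qed.

(** For fixed [v], the constraint qualification writes [a *: v], for some [a > 0], as
$y_0 + D_0(c - x_0) - k$.  Replacing $y_0$, $D_0$ and $D_0 x_0$ by their approximations at
[t] costs $\delta_t\|\mu_t\|$ times a constant that depends on [v] only, and what remains
is bounded below by hypothesis.  Hence $\mu_t / (1 + \delta_t\|\mu_t\|)$ is pointwise,
therefore uniformly, bounded. *)
Lemma multipliers_bounded (C : set X) (K : set Y) (y0 : Y) (x0 : X)
    (D0 : continuous_linear X Y) (T : Type) (F : set_system T)
    {FF : ProperFilter F} (A : set T) (x : T -> X) (y : T -> Y)
    (D : T -> continuous_linear X Y) (mu : T -> dual Y) (M : R) :
  interior [set y0 + D0 (c - x0) - k | c in C & k in K] 0 ->
  F A -> (forall t, A t -> `|x t| <= M) ->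
  y @ F --> y0 -> D @ F --> D0 -> D0 (x t) @[t --> F] --> D0 x0 ->
  (forall c, C c -> exists m, forall t, A t -> m <= mu t (D t (c - x t))) ->
  (forall k, K k -> exists m, forall t, A t -> mu t (k - y t) <= m) ->
  exists2 N, 0 <= N & \forall t \near F, `|mu t| <= N.
Proof.
move=> rcq FA xM yy0 DD0 D0x stat comp.
pose delta t := `|y0 - y t| + `|D0 - D t| + `|D0 x0 - D0 (x t)|.
have delta0 : delta @ F --> 0.
  rewrite -[0]addr0 -[X in X + _]addr0; apply: cvgD; first apply: cvgD.
  - exact: cvg_norm_sub0.
  - exact: cvg_norm_sub0.
  - exact: cvg_norm_sub0.
pose s t := 1 + delta t * `|mu t|.
have delta_ge0 t : 0 <= delta t by rewrite !addr_ge0.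
have s_ge1 t : 1 <= s t by rewrite lerDl mulr_ge0.
have s_gt0 t : 0 < s t by rewrite (lt_le_trans ltr01).
have lower v : exists m, forall t, A t -> - (m * s t) <= mu t v.
  have [/= r r0 ball_rcq] := (nbhs_ballP _ _).1 rcq.
  pose a := r / (2 * (`|v| + 1)).
  have a0 : 0 < a by rewrite divr_gt0// mulr_gt0// ltr_wpDl.
  have [|c Cc [k Kk ckE]] := ball_rcq (a *: v).
    rewrite -ball_normE /= sub0r normrN normrZ gtr0_norm// /a.
    have -> : r / (2 * (`|v| + 1)) * `|v| = r / 2 * (`|v| / (`|v| + 1)).
      by rewrite invfM -!mulrA; congr (_ * (_ * _)); rewrite mulrC.
    apply: (@le_lt_trans _ _ (r / 2)).
      rewrite ler_piMr ?divr_ge0 ?(ltW r0)// ler_pdivrMr ?ltr_wpDl//.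
      by rewrite mul1r lerDl.
    by rewrite ltr_pdivrMr// ltr_pMr// ltr1n.
  have [m1 m1P] := stat c Cc; have [m2 m2P] := comp k Kk.
  pose m := (`|m1| + `|m2| + (2 + (`|c| + `|M|))) / a.
  exists m => t At.
  have split_av : a *: v = (y0 - y t) - (k - y t) + D t (c - x t)
      + (D0 - D t) (c - x t) - (D0 x0 - D0 (x t)).
    rewrite -ckE; change ((D0 - D t) (c - x t)) with (D0 (c - x t) - D t (c - x t)).
    have -> : y0 - y t - (k - y t) = y0 - k by rewrite opprB addrA subrK.
    rewrite -[y0 - k + _ + _]addrA [D t _ + _]addrC subrK.
    have D0B u v' : D0 (u - v') = D0 u - D0 v' by rewrite linearB.
    rewrite !D0B opprB -[RHS]addrA [_ - _ + (_ - _)]addrA subrK.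
    by rewrite addrAC.
  have mu_le (u : Y) e : `|u| <= e * delta t -> - (e * (delta t * `|mu t|)) <= mu t u.
    move=> ue; rewrite lerNl; apply: le_trans (ler_norm _) _; rewrite normrN.
    apply: le_trans (ler_opnorm _ _) _; rewrite mulrC mulrA.
    by rewrite ler_wpM2r.
  have b1 : - (1 * (delta t * `|mu t|)) <= mu t (y0 - y t).
    by apply: mu_le; rewrite mul1r /delta -addrA lerDl addr_ge0.
  have b2 : - ((`|c| + `|M|) * (delta t * `|mu t|)) <= mu t ((D0 - D t) (c - x t)).
    apply: mu_le; apply: le_trans (ler_opnorm _ _) _; rewrite mulrC.
    apply: ler_pM => //; last by rewrite /delta addrAC lerDr addr_ge0.
    apply: le_trans (ler_normB _ _) _; rewrite lerD2l.
    by apply: le_trans (xM t At) (ler_norm M).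
  have b3 : - (1 * (delta t * `|mu t|)) <= mu t (- (D0 x0 - D0 (x t))).
    by apply: mu_le; rewrite mul1r normrN /delta lerDr addr_ge0.
  have : a * mu t v = mu t (y0 - y t) - mu t (k - y t) + mu t (D t (c - x t))
      + mu t ((D0 - D t) (c - x t)) + mu t (- (D0 x0 - D0 (x t))).
    have -> : a * mu t v = mu t (a *: v) by rewrite linearZ.
    rewrite split_av; move: (y0 - y t) (k - y t) (D t (c - x t))
      ((D0 - D t) (c - x t)) (D0 x0 - D0 (x t)) => u1 u2 u3 u4 u5.
    have muD u u' : mu t (u + u') = mu t u + mu t u' by rewrite linearD.
    have muN u : mu t (- u) = - mu t u by rewrite linearN.
    by rewrite !muD !muN.
  rewrite -(ler_pM2l a0) mulrN => amu.
  have -> : a * (m * s t) = (`|m1| + `|m2| + (2 + (`|c| + `|M|))) * s t.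
    by rewrite mulrA [a * m]mulrC divfK ?gt_eqF.
  have dmu0 : 0 <= delta t * `|mu t| by rewrite mulr_ge0.
  rewrite amu /s.
  exact: (lower_bound_arith b1 b2 b3 (m1P t At) (m2P t At) dmu0 (normr_ge0 c)).
pose nu t := (s t)^-1 *: mu t.
have [|N N0 nuN] := @uniform_boundedness _ Y R^o T A nu.
  move=> v; have [m1 m1P] := lower v; have [m2 m2P] := lower (- v).
  exists (Num.max m1 m2) => t At.
  change (`|(s t)^-1 * mu t v| <= Num.max m1 m2).
  rewrite normrM ger0_norm ?invr_ge0 ?(ltW (s_gt0 t))// ler_pdivrMl// mulrC.
  rewrite ler_norml; apply/andP; split.
    apply: le_trans (m1P t At); rewrite lerN2 ler_wpM2r ?(ltW (s_gt0 t))//.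
    by rewrite le_max lexx.
  have := m2P t At; rewrite linearN /= lerN2 => /le_trans; apply.
  by rewrite ler_wpM2r ?(ltW (s_gt0 t))// le_max lexx orbT.
(* As soon as $N\delta_t \le 1/2$, the bound $\|\mu\| \le N(1 + \delta\|\mu\|)$ gives
$\|\mu\| \le 2N$. *)
exists (N *+ 2); first by rewrite mulrn_wge0.
have N1 : 0 < (2 * (N + 1))^-1 by rewrite invr_gt0 mulr_gt0// ltr_wpDl.
move/cvgr0Pnorm_le : delta0 => /(_ _ N1); apply: filterS2 FA => t At.
rewrite ger0_norm// => dN.
have : `|mu t| <= N * s t.
  have -> : mu t = s t *: nu t by rewrite scalerA divff ?gt_eqF// scale1r.
  by rewrite normrZ gtr0_norm// mulrC ler_wpM2r ?nuN// ltW.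
rewrite /s mulrDr mulr1 mulrA => muN.
have : N * delta t * `|mu t| <= 2^-1 * `|mu t|.
  rewrite ler_wpM2r//; apply: le_trans (ler_wpM2l N0 dN) _.
  rewrite invfM mulrCA ler_piMr// ler_pdivrMr ?ltr_wpDl// mul1r.
  by rewrite lerDl.
move: muN; move: (N * delta t * `|mu t|) => p; move: `|mu t| => q; lra.
Qed.

End MultiplierBound.

(** * The augmented Lagrangian method *)

Section Iteration.
Context {R : realType} {X Y : normedModType R} {H : completeNormedModType R}.
Variables (ip : inner_product H) (i : continuous_linear Y H) (calK : set H).
Variables (F : X -> dual X) (G : X -> X -> Y) (DG : X -> X -> continuous_linear X Y).
Variables (x : X) (w : H) (r : R).
Hypotheses (calK0 : calK !=set0) (closed_calK : closed calK).
Hypotheses (convex_calK : convex_set calK) (r_gt0 : 0 < r).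

Let z := shifted_constraint i G x w r.
Let p := metric_projection calK z.
Let l := r *: (z - p).

(** The penalty term of the augmented Lagrangian is the adjoint of the derivative applied
to the updated multiplier [l]. *)
Lemma stationarity_inequality (C : set X) (e : dual X) (c : X) :
  normal_cone C x (e - augmented_Lagrangian ip i calK F G DG r x w) -> C c ->
  e (c - x) - F x (c - x) <= pivot ip i l (DG x x (c - x)).
Proof.
move=> nC Cc; have := nC c Cc.
change (e (c - x) - (F x (c - x) + r * ip (z - p) (i (DG x x (c - x)))) <= 0 ->
  e (c - x) - F x (c - x) <= ip l (i (DG x x (c - x)))).
by rewrite ipZl opprD addrA subr_le0.
Qed.

(** With [d = i (G x x) - p] one has [l = r *: d + w].  Since $(l, s - p) \le 0$, what is
left of $(l, s - iG)$ is at most $-(l, d) = -r\|d\|^2 - (w, d)$. *)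
Lemma multiplier_inequality (s : H) : calK s ->
  ip l (s - i (G x x)) <= `|w| * infeasibility i calK G x w r.
Proof.
move=> Ks; have np := metric_projection_nearest ip z calK0 closed_calK convex_calK.
pose d := i (G x x) - p.
have lE : l = r *: d + w.
  by rewrite /l /z /shifted_constraint addrAC scalerDr scalerA divff ?gt_eqF// scale1r.
have -> : s - i (G x x) = (s - p) - d by rewrite /d opprB addrA subrK.
rewrite ipDr ipNr; have : ip l (s - p) <= 0.
  by rewrite ipZl pmulr_rle0//; exact: (nearest_obtuse ip convex_calK np Ks).
have : - ip l d <= `|w| * `|d|.
  rewrite lE ipDl ipZl inner_product_norm opprD -ipNr.
  have := inner_product_le ip w (- d); rewrite normrN.
  have : 0 <= r * `|d| ^+ 2 by rewrite mulr_ge0 ?(ltW r_gt0)// exprn_ge0.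
  by move: (r * _) (ip w _) (`|w| * _) => a b c; lra.
rewrite -/(infeasibility i calK G x w r) /infeasibility -/z -/p -/d.
by move: (ip l d) (ip l _) (`|w| * _) => a b c; lra.
Qed.

End Iteration.

Section AugmentedLagrangianConvergence.
Context {R : realType} {X Y H : completeNormedModType R}.
Variables (ip : inner_product H) (i : continuous_linear Y H).
Variables (C : set X) (K : set Y) (calK : set H).
Variables (F : X -> dual X) (G : X -> X -> Y) (DG : X -> X -> continuous_linear X Y).
Variables (B : set H) (x : nat -> X) (lam w : nat -> H) (rho : nat -> R).
Variables (eps : nat -> dual X) (I : set nat) (xbar : X).
Hypotheses (closedC : closed C) (convexC : convex_set C).
Hypotheses (K0 : K !=set0) (closed_calK : closed calK).
Hypotheses (convex_calK : convex_set calK) (calKE : i @^-1` calK = K).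
Hypothesis DG_diff : forall u v : X, is_diff v (G u) (DG u v).
Hypothesis bounded_B : bounded_set B.
Hypothesis Bw : forall k, B (w k).
Hypothesis rho_gt0 : forall k, 0 < rho k.
Hypothesis lamE : forall k, let z := shifted_constraint i G (x k.+1) (w k) (rho k) in
  lam k.+1 = rho k *: (z - metric_projection calK z).
Hypotheses (bounded_F : bounded_operator F) (pseudo_F : pseudomonotone F).
Hypothesis cc_G : completely_continuous (fun p : X * X => G p.1 p.2).
Hypothesis cc_DG : completely_continuous (fun p : X * X => DG p.1 p.2).
Hypothesis Cx : forall k, C (x k.+1).
Hypothesis stationary : forall k, normal_cone C (x k.+1)
  (eps k.+1 - augmented_Lagrangian ip i calK F G DG (rho k) (x k.+1) (w k)).
Hypothesis eps0 : eps k @[k --> \oo] --> (0 : dual X).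
Hypothesis infI : infinite_set I.
Hypothesis xbar_lim : weakly_cvg (x k @[k --> within I \oo]) xbar.
Hypothesis ercq : ERCQ C K G DG xbar.
Let V k := infeasibility i calK G (x k.+1) (w k) (rho k).
Hypothesis penalty : V @ \oo --> 0 \/ (fun k => (rho k)^-1) @ \oo --> 0.

Let FI := within I \oo.
Local Instance FI_proper : ProperFilter FI := within_infinite_proper infI.

Let D0 := DG xbar xbar.
Let y0 := G xbar xbar.
Let mu k : dual Y := pivot ip i (lam k).
(* [x 0] and [lam 0] are arbitrary, hence the restriction to positive indices. *)
Let A := [set k | I k /\ (0 < k)%N].

Let FIA : FI A.
Proof. by exists 1%N => // k /= k0 Ik; split. Qed.

Let FI_oo (P : set nat) : \oo P -> FI P.
Proof. by apply: filterS => k Pk _. Qed.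

Let cvg_FI (T : topologicalType) (u : nat -> T) (l : T) : u @ \oo --> l -> u @ FI --> l.
Proof. by move=> ul P /ul; exact: FI_oo. Qed.

Let cvg_pred_FI (T : topologicalType) (u : nat -> T) (l : T) :
  u @ \oo --> l -> u k.-1 @[k --> FI] --> l.
Proof.
move=> ul P /ul[N _ NP]; apply: FI_oo; exists N.+1 => // -[//|k] /= Nk.
exact: NP.
Qed.

Let pair_lim : weakly_cvg ((fun k => (x k, x k)) @ FI) (xbar, xbar).
Proof. exact: weakly_cvg_pair. Qed.

Let G_lim : G (x k) (x k) @[k --> FI] --> y0.
Proof. exact: (completely_continuous_within cc_G pair_lim). Qed.

Let D_lim : DG (x k) (x k) @[k --> FI] --> D0.
Proof. exact: (completely_continuous_within cc_DG pair_lim). Qed.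

Let D0_cc : completely_continuous D0.
Proof.
apply: (completely_continuous_derivative (DG_diff xbar xbar)) => u u0 uu0.
apply: (cc_G (z := fun k => (xbar, u k)) (z0 := (xbar, u0))).
by apply: weakly_cvg_pair => //; exact: weakly_cvg_seq_cst.
Qed.

Let D0x_lim : D0 (x k) @[k --> FI] --> D0 xbar.
Proof. exact: (completely_continuous_within D0_cc xbar_lim). Qed.

Let x_bounded : exists2 M, 0 <= M & forall k, I k -> `|x k| <= M.
Proof. exact: (weakly_cvg_within_bounded xbar_lim). Qed.

Let Dx_lim (y : X) : DG (x k) (x k) (y - x k) @[k --> FI] --> D0 (y - xbar).
Proof.
have [M M0 xM] := x_bounded.
apply: (cvg_operator_apply (M := `|y| + M) D_lim).
  apply: filterS FIA => k [Ik _].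
  by rewrite (le_trans (ler_normB _ _))// lerD2l xM.
rewrite linearB; under eq_fun do rewrite linearB.
by apply: cvgB D0x_lim; exact: cvg_cst.
Qed.

Let C_xbar : C xbar.
Proof.
apply: (closed_convex_weakly_closed closedC convexC _ xbar_lim).
by apply: filterS FIA => k [_]; case: k => // k _; exact: Cx.
Qed.

Let w_bounded : exists2 W, 0 <= W & forall k, `|w k| <= W.
Proof.
by have [W W0 BW] := (bounded_setP B).1 bounded_B; exists W => // k; apply: BW.
Qed.

Let calK0 : calK !=set0.
Proof. by have [k Kk] := K0; exists (i k); move: Kk; rewrite -calKE. Qed.

Let residual k c : A k -> C c ->
  eps k (c - x k) - F (x k) (c - x k) <= mu k (DG (x k) (x k) (c - x k)).
Proof.
move=> [_]; case: k => // k _ Cc; rewrite /mu lamE.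
exact: stationarity_inequality (stationary k) Cc.
Qed.

Let residual_bounded c : exists m, forall k, A k -> m <= eps k (c - x k) - F (x k) (c - x k).
Proof.
have [M M0 xM] := x_bounded.
have [E E0 epsE] := cvg_seq_norm_le eps0.
have [N N0 FN] : exists2 N, 0 <= N & forall k, I k -> `|F (x k)| <= N.
  have /(bounded_F)/bounded_setP[N N0 FN] : bounded_set (x @` I).
    by apply/bounded_setP; exists M => // _ [k Ik <-]; exact: xM.
  by exists N => // k Ik; apply: FN; exists (x k) => //; exists k.
exists (- ((E + N) * (`|c| + M))) => k [Ik _].
rewrite lerNl; apply: le_trans (ler_norm _) _; rewrite normrN.
change (`|(eps k - F (x k)) (c - x k)| <= (E + N) * (`|c| + M)).
apply: le_trans (ler_opnorm _ _) _; apply: ler_pM => //.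
  by rewrite (le_trans (ler_normB _ _))// lerD ?FN.
by rewrite (le_trans (ler_normB _ _))// lerD2l xM.
Qed.

(* [v k] is the infeasibility at [x k]; it only makes sense for [k > 0]. *)
Let v k := V k.-1.

Let complementarity W k y : (forall k, `|w k| <= W) -> A k -> K y ->
  mu k (y - G (x k) (x k)) <= W * v k.
Proof.
move=> wW [_]; case: k => // k _ Ky; rewrite /mu lamE.
change (ip (rho k *: (shifted_constraint i G (x k.+1) (w k) (rho k) -
  metric_projection calK (shifted_constraint i G (x k.+1) (w k) (rho k))))
  (i (y - G (x k.+1) (x k.+1))) <= W * V k).
have Kiy : calK (i y) by move: Ky; rewrite -calKE.
have -> : i (y - G (x k.+1) (x k.+1)) = i y - i (G (x k.+1) (x k.+1)).
  by rewrite linearB.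
have := multiplier_inequality ip i G (x k.+1) (w k) calK0 closed_calK convex_calK
  (rho_gt0 k) Kiy.
by move=> /le_trans; apply; rewrite ler_wpM2r ?normr_ge0.
Qed.

(** If [V] tends to [0], then [p k] is a sequence of [calK] asymptotic to
[i (G (x k) (x k))].  Otherwise ERCQ writes [0] as [y0 + D0 (c - xbar) - k]; paired with
the residual [zb - pb] of the limit, the terms [D0 (c - xbar)] and [pb - i k] contribute
nonnegatively and the remaining one is $\|zb - pb\|^2$, which therefore vanishes. *)
Let feasible_and_v_lim : K y0 /\ v @ FI --> 0.
Proof.
have v_infeas : (V @ \oo --> 0) -> v @ FI --> 0 by exact: cvg_pred_FI.
have [M M0 xM] := x_bounded; have [W W0 wW] := w_bounded.
pose z k := shifted_constraint i G (x k) (w k.-1) (rho k.-1).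
pose p k := metric_projection calK (z k).
have np k : nearest calK (z k) (p k) by exact: (metric_projection_nearest ip).
have iG_lim : i (G (x k) (x k)) @[k --> FI] --> i y0.
  exact: cvg_continuous_linear G_lim.
have v_norm k : A k -> v k = `|i (G (x k) (x k)) - p k|.
  by move=> [_]; case: k.
have [V0|rhoV0] := penalty.
  have v0 := v_infeas V0; split=> //.
  rewrite -calKE /=.
  have p_lim : p @ FI --> i y0.
    have -> : p = (fun k => i (G (x k) (x k)) - (i (G (x k) (x k)) - p k)).
      by apply/funext => k; rewrite opprB addrC subrK.
    rewrite -[i y0]subr0; apply: cvgB => //.
    apply: (squeeze_norm _ v0); apply: filterS FIA => k Ak.
    by rewrite subr0 v_norm.
  have pK : \forall k \near FI, calK (p k) by apply: nearW => k; case: (np k).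
  exact: (closed_cvg calK closed_calK pK _ p_lim).
pose zb := i y0; pose pb := metric_projection calK zb.
have npb : nearest calK zb pb by exact: (metric_projection_nearest ip).
have r0 : (rho k.-1)^-1 @[k --> FI] --> 0 := cvg_pred_FI rhoV0.
have z_lim : z @ FI --> zb.
  rewrite -[zb]addr0; apply: cvgD => //.
  apply: (@squeeze_norm _ _ _ _ _ _ _ (fun k => (rho k.-1)^-1 * W)).
    apply: nearW => k; rewrite subr0 normrZ ger0_norm ?invr_ge0 ?(ltW (rho_gt0 _))//.
    by rewrite ler_wpM2l ?invr_ge0 ?(ltW (rho_gt0 _)).
  by rewrite -(mul0r W); apply: cvgM r0 _; exact: cvg_cst.
have p_lim : p @ FI --> pb.
  apply: (squeeze_norm _ (e := fun k => `|zb - z k|)).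
    apply: nearW => k; rewrite [leRHS]distrC.
    exact: (nearest_nonexpansive ip convex_calK (np k) npb).
  exact: cvg_norm_sub0.
have zp_stat c : C c -> 0 <= ip (zb - pb) (i (D0 (c - xbar))).
  move=> Cc; have [m mP] := residual_bounded c.
  have l_lim : ip (z k - p k) (i (DG (x k) (x k) (c - x k))) @[k --> FI] -->
      ip (zb - pb) (i (D0 (c - xbar))).
    apply: cvg_inner_product; first exact: (cvgB z_lim p_lim).
    exact: cvg_continuous_linear (@Dx_lim c).
  have m_lim : (rho k.-1)^-1 * m @[k --> FI] --> 0.
    by rewrite -(mul0r m); apply: cvgM r0 _; exact: cvg_cst.
  apply: (ler_cvg_to m_lim l_lim); apply: filterS FIA => k Ak.
  rewrite ler_pdivrMl ?rho_gt0//; apply: le_trans (mP k Ak) _.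
  apply: le_trans (residual Ak Cc) _.
  move: Ak => [_]; rewrite /mu; case: k => // k _; rewrite lamE /=.
  change (ip (rho k *: (z k.+1 - p k.+1)) (i (DG (x k.+1) (x k.+1) (c - x k.+1))) <=
    rho k * ip (z k.+1 - p k.+1) (i (DG (x k.+1) (x k.+1) (c - x k.+1)))).
  by rewrite ipZl.
have [c Cc [k Kk ckE]] := interior_subset ercq.
have zb_pb : zb = pb.
  apply/eqP; rewrite -subr_eq0 -normr_eq0 -sqrf_eq0; apply/eqP/le_anti.
  rewrite sqr_ge0 andbT -(inner_product_norm ip).
  have Kik : calK (i k) by move: Kk; rewrite -calKE.
  have h1 := nearest_obtuse ip convex_calK npb Kik.
  have h2 := zp_stat c Cc.
  have : ip (zb - pb) (i (y0 + D0 (c - xbar) - k)) = 0.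
    by rewrite ckE !linear0.
  have -> : i (y0 + D0 (c - xbar) - k) = (zb - pb) + i (D0 (c - xbar)) - (i k - pb).
    by rewrite opprB [zb - pb + _]addrAC addrA subrK linearB linearD.
  by rewrite ipDr ipNr ipDr; move: (ip _ _) (ip _ _) (ip _ _) h1 h2 => a b d; lra.
split; first by rewrite -calKE /=; change (calK zb); rewrite zb_pb; case: npb.
apply: (squeeze_norm _ (e := fun k => `|(i (G (x k) (x k)) - p k) - (zb - pb)|)).
  apply: filterS FIA => j Aj; rewrite zb_pb subrr !subr0 v_norm//.
  by rewrite ger0_norm.
under eq_fun do rewrite distrC; apply: cvg_norm_sub0.
exact: (cvgB iG_lim p_lim).
Qed.

Let mu_bounded : exists2 N, 0 <= N & \forall k \near FI, `|mu k| <= N.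
Proof.
have [M M0 xM] := x_bounded; have [W W0 wW] := w_bounded.
have v1 : \forall k \near FI, v k <= 1.
  have /cvgr0Pnorm_le/(_ _ ltr01) := feasible_and_v_lim.2.
  by apply: filterS => k; exact: le_trans (ler_norm _).
have FIA1 : FI (A `&` [set k | v k <= 1]) by exact: filterI FIA v1.
apply: (multipliers_bounded ercq FIA1 _ G_lim D_lim D0x_lim).
- by move=> k [[Ik _] _]; exact: xM.
- move=> c Cc; have [m mP] := residual_bounded c.
  by exists m => k [Ak _]; exact: le_trans (mP k Ak) (residual Ak Cc).
- move=> y Ky; exists W => k [Ak vk].
  apply: le_trans (complementarity wW Ak Ky) _.
  by rewrite ler_piMr.
Qed.

Lemma feasible_limit : C xbar /\ K (G xbar xbar).
Proof. by split=> //; case: feasible_and_v_lim. Qed.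

Lemma bounded_multiplier_sequence : bounded_set [set pivot ip i (lam k) | k in I].
Proof.
have [N N0 [n _ muN]] := mu_bounded.
apply/bounded_setP; exists (N + \sum_(j < n) `|mu j|).
  by rewrite addr_ge0// sumr_ge0.
move=> _ [k Ik <-]; rewrite -/(mu k).
have [nk|kn] := leqP n k.
  by apply: le_trans (muN k nk Ik) _; rewrite lerDl sumr_ge0.
rewrite (bigD1 (Ordinal kn))//= addrCA lerDl addr_ge0//.
by rewrite sumr_ge0.
Qed.

Section Accumulation.
Variable lambar : dual Y.
Hypothesis acc : weak_star_accumulation_points (mu @ FI) lambar.

(** At any given [k], [lambar] is approximated by terms of [mu], for which the normal cone
inequality holds up to errors that vanish along [I]. *)
Lemma accumulation_normal_cone : normal_cone K (G xbar xbar) lambar.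
Proof.
move=> k Kk; apply/ler_addgt0Pr => e e0; rewrite add0r.
have [W W0 wW] := w_bounded; have [N N0 muN] := mu_bounded.
have e3 : 0 < e / 3 by rewrite divr_gt0.
have near_err : \forall j \near FI, W * v j + N * `|y0 - G (x j) (x j)| <= e / 3.
  have : W * v j + N * `|y0 - G (x j) (x j)| @[j --> FI] --> (0 : R).
    have -> : 0 = W * 0 + N * 0 by rewrite !mulr0 addr0.
    apply: cvgD.
      by apply: cvgM; [exact: cvg_cst|exact: feasible_and_v_lim.2].
    by apply: cvgM; [exact: cvg_cst|exact: cvg_norm_sub0].
  move=> /cvgr0Pnorm_le/(_ _ e3); apply: filterS => j.
  exact: le_trans (ler_norm _).
have [j [[Aj muj] errj] approx] := weak_star_accumulation_approx
  (k - y0) acc (filterI (filterI FIA muN) near_err) e3.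
have h1 := complementarity wW Aj Kk.
have h2 : - mu j (y0 - G (x j) (x j)) <= N * `|y0 - G (x j) (x j)|.
  apply: le_trans (ler_norm _) _; rewrite normrN.
  by apply: le_trans (ler_opnorm _ _) _; rewrite ler_wpM2r.
have h3 : mu j (k - y0) = mu j (k - G (x j) (x j)) - mu j (y0 - G (x j) (x j)).
  have -> : k - y0 = (k - G (x j) (x j)) - (y0 - G (x j) (x j)).
    by rewrite opprB addrA subrK.
  by rewrite linearB.
have h4 := le_lt_trans (ler_norm _) approx.
rewrite -/y0; move: h1 h2 h3 h4 errj.
move: (lambar _) (mu j _) (mu j _) (mu j _) (W * _) (N * _) => a b c d p q.
by move=> h1 h2 h3 h4 h5; lra.
Qed.

(** The subsequence [s] is chosen for the single direction [y - xbar].  Along it the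
stationarity inequality bounds the pairings in the definition of pseudomonotonicity, with
limits [0] for [c = xbar] and [lambar d] for [c = y]. *)
Lemma accumulation_stationary :
  normal_cone C xbar (- (F xbar + adjoint D0 lambar)).
Proof.
move=> y Cy; have [N N0 muN] := mu_bounded.
pose d := D0 (y - xbar).
have [s [sP s_lim]] : exists s : nat -> nat,
    (forall n, I (s n) /\ [/\ A (s n), `|mu (s n)| <= N & `|lambar d - mu (s n) d| < n.+1%:R^-1])
    /\ s @ \oo --> FI.
  apply: (@subsequence_within I (fun n k =>
    [/\ A k, `|mu k| <= N & `|lambar d - mu k d| < n.+1%:R^-1])) => n.
  have FIn : FI [set k | (n <= k)%N] by apply: FI_oo; exists n.
  have n0 : 0 < n.+1%:R^-1 :> R by rewrite invr_gt0.
  have [k [[Ak muk] nk] approx] := weak_star_accumulation_approx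
    d acc (filterI (filterI FIA muN) FIn) n0.
  by exists k; split=> //; case: Ak.
have xs_lim : weakly_cvg ((x \o s) @ \oo) xbar.
  by move=> psi; apply: cvg_trans (@xbar_lim psi); exact: cvg_app s_lim.
have eps_lim z : eps k (z - x k) @[k --> FI] --> 0.
  have [M M0 xM] := x_bounded.
  apply: (squeeze_norm _ (e := fun k => `|0 - eps k| * (`|z| + M))).
    apply: filterS FIA => k [Ik _]; rewrite subr0 sub0r normrN.
    apply: le_trans (ler_opnorm _ _) _; rewrite ler_wpM2l//.
    by rewrite (le_trans (ler_normB _ _))// lerD2l xM.
  rewrite -(mul0r (`|z| + M)); apply: cvgM; last exact: cvg_cst.
  exact: cvg_norm_sub0 (cvg_FI eps0).
have muD_lim z (l : R) : mu (s n) (D0 (z - xbar)) @[n --> \oo] --> l ->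
    mu (s n) (DG (x (s n)) (x (s n)) (z - x (s n))) - eps (s n) (z - x (s n))
      @[n --> \oo] --> l.
  move=> mul; rewrite -[l]subr0.
  have e_lim : eps (s n) (z - x (s n)) @[n --> \oo] --> (0 : R).
    exact: (cvg_comp _ _ s_lim (@eps_lim z)).
  apply: (cvgB _ e_lim).
  pose q k := D0 (z - xbar) - DG (x k) (x k) (z - x k).
  have -> : (fun n => mu (s n) (DG (x (s n)) (x (s n)) (z - x (s n)))) =
      (fun n => mu (s n) (D0 (z - xbar)) - mu (s n) (q (s n))).
    by apply/funext => n; rewrite -linearB /q opprB [in RHS]addrC subrK.
  rewrite -[l]subr0; apply: cvgB => //.
  apply: (squeeze_norm _ (e := fun n => N * `|q (s n)|)).
    apply: nearW => n; have [_ [_ muN' _]] := sP n.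
    by rewrite subr0; apply: le_trans (ler_opnorm _ _) _; rewrite ler_wpM2r.
  rewrite -(mulr0 N); apply: cvgM; first exact: cvg_cst.
  exact: (cvg_comp _ _ s_lim (cvg_norm_sub0 (@Dx_lim z))).
have mu_d : mu (s n) d @[n --> \oo] --> lambar d.
  apply: (squeeze_norm _ (@cvg_harmonic R)); apply: nearW => n.
  by have [_ [_ _ /ltW]] := sP n; rewrite distrC.
have mu_0 : mu (s n) (D0 (xbar - xbar)) @[n --> \oo] --> 0.
  by rewrite subrr linear0; under eq_fun do rewrite linear0; exact: cvg_cst.
have F_le c : C c -> forall n, F (x (s n)) (x (s n) - c) <=
    mu (s n) (DG (x (s n)) (x (s n)) (c - x (s n))) - eps (s n) (c - x (s n)).
  move=> Cc n; have [_ [Asn _ _]] := sP n; have := residual Asn Cc.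
  have -> : F (x (s n)) (x (s n) - c) = - F (x (s n)) (c - x (s n)).
    by rewrite -linearN opprB.
  by rewrite lerBrDr addrC.
have := pseudomonotone_le pseudo_F xs_lim (F_le _ C_xbar) (muD_lim _ _ mu_0)
  (F_le _ Cy) (muD_lim _ _ mu_d).
change (F xbar (xbar - y) <= lambar (D0 (y - xbar)) ->
  - (F xbar (y - xbar) + lambar (D0 (y - xbar))) <= 0).
have -> : F xbar (xbar - y) = - F xbar (y - xbar) by rewrite -linearN opprB.
move: (F xbar (y - xbar)) (lambar (D0 (y - xbar))) => a b; lra.
Qed.

End Accumulation.

End AugmentedLagrangianConvergence.

Theorem theorem7p4 (R : realType) (X Y H : completeNormedModType R)
    (ip : inner_product H) (i : continuous_linear Y H)
    (C : set X) (K : set Y) (calK : set H)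
    (F : X -> dual X) (G : X -> X -> Y) (DG : X -> X -> continuous_linear X Y)
    (gamma tau : R) (B : set H)
    (x : nat -> X) (lam w : nat -> H) (rho : nat -> R)
    (eps : nat -> dual X) (I : set nat) (xbar : X) :
  C !=set0 -> closed C -> convex_set C ->
  K !=set0 -> closed K -> convex_set K ->
  injective i -> dense (range i) ->
  closed calK -> convex_set calK -> i @^-1` calK = K ->
  (forall u v : X, is_diff v (G u) (DG u v)) ->
  ALM_sequences i calK G gamma tau B x lam w rho ->
  bounded_operator F -> pseudomonotone F ->
  completely_continuous (fun p : X * X => G p.1 p.2) ->
  completely_continuous (fun p : X * X => DG p.1 p.2) ->
  (forall k, C (x k.+1)) ->
  (forall k, normal_cone C (x k.+1)
     (eps k.+1 - augmented_Lagrangian ip i calK F G DG (rho k) (x k.+1) (w k))) ->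
  eps k @[k --> \oo] --> (0 : dual X) ->
  infinite_set I ->
  weakly_cvg (x k @[k --> within I \oo]) xbar ->
  ERCQ C K G DG xbar ->
  [/\ C xbar /\ K (G xbar xbar),
      bounded_set [set pivot ip i (lam k) | k in I]
    & forall lambar : dual Y,
        weak_star_accumulation_points (pivot ip i (lam k) @[k --> within I \oo])
          lambar ->
        Lagrange_multiplier C K F G DG xbar lambar].
Proof.
move=> _ closedC convexC K0 _ _ _ _ closed_calK convex_calK calKE DG_diff alm.
move=> bounded_F pseudo_F cc_G cc_DG Cx stationary eps0 infI xbar_lim ercq.
have [rho0 gamma1 tau01 bounded_B Bw lamE rhoS] := alm.
have [||rho_ge penalty] := @penalty_dichotomy R rho
    (fun k => infeasibility i calK G (x k.+1) (w k) (rho k)) gamma tau rho0 gamma1 tau01.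
- by move=> k; exact: normr_ge0.
- by move=> k; rewrite rhoS; case: k.
have rho_gt0 k : 0 < rho k by exact: lt_le_trans (rho_ge k).
split.
- exact: (feasible_limit (ip := ip) closedC convexC K0 closed_calK convex_calK
    calKE DG_diff bounded_B Bw rho_gt0 lamE bounded_F cc_G cc_DG Cx stationary
    eps0 infI xbar_lim ercq penalty).
- exact: (bounded_multiplier_sequence (ip := ip) K0 closed_calK convex_calK
    calKE DG_diff bounded_B Bw rho_gt0 lamE bounded_F cc_G cc_DG stationary
    eps0 infI xbar_lim ercq penalty).
move=> lambar acc; split.
- exact: (accumulation_stationary closedC convexC K0 closed_calK convex_calK
    calKE DG_diff bounded_B Bw rho_gt0 lamE bounded_F pseudo_F cc_G cc_DG Cx stationary
    eps0 infI xbar_lim ercq penalty acc).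
- exact: (accumulation_normal_cone K0 closed_calK convex_calK
    calKE DG_diff bounded_B Bw rho_gt0 lamE bounded_F cc_G cc_DG stationary
    eps0 infI xbar_lim ercq penalty acc).
Qed.
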